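(* Consider the exponential family mixture model described in the context with $M=\infty$, suppose that $p_0$ has mean zero, and that there are constants $\alpha_1\ge\alpha_2>0$ and $c_0,c_1,c_2>0$ such that $$c_1|\theta|^{1+1/\alpha_1}\le\kappa(\theta)\le c_2|\theta|^{1+1/\alpha_2},\qquad |\theta|\ge c_0 .$$ Suppose also that there exist $\beta_0>0$ and $b_0,b_1>0$ such that (for all $n$) $$\mathbb{P}(|X|_n\ge t)\le n\exp(-b_1t^{\beta_0}),\qquad t\ge b_0 .$$ Put $$\gamma_0=2\Big(\frac{1+\alpha_1}{\beta_0}\vee 1\Big),\qquad \gamma_1=\frac{\beta_0}{2(1+\alpha_1)}\wedge 1 .$$ Let $A>0$ be a constant and let $\tilde g\in\mathcal{G}$ be an approximate NPMLE satisfying $$\ell_n(f_{\hat g})-\ell_n(f_{\tilde g})\le A(\log n)^{\gamma_0} .$$ Then there exists a constant $C_{p_0,g_0,A}>0$, depending only on $p_0$, $g_0$ and $A$, such that $$\mathbb{P}\Big(H^2(f_{\tilde g},f_{g_0})\ge t\,C_{p_0,g_0,A}\frac{(\log n)^{\gamma_0}}{n}\Big)\le 2\exp\big(-t^{\gamma_1}\log n\big)$$ for all $t\ge 1$ and $n\ge C_{p_0,g_0,A}$.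
   Context: Exponential family mixture model with $M=\infty$. Let $p_0$ be a probability density on $\mathbb{R}$ with respect to a dominating measure $\mu$. Put $Z(\theta)=\int \exp(\theta x)p_0(x)\,\mathrm{d}\mu(x)$, $\kappa(\theta)=\log Z(\theta)$, $\Theta=\{\theta\in\mathbb{R}:Z(\theta)<\infty\}$, and assume $\Theta=\mathbb{R}$. Put $p_\theta(x)=\exp(\theta x-\kappa(\theta))p_0(x)$ for $\theta\in\mathbb{R}$. Let $\mathcal{G}$ be the set of all probability distributions on $\mathbb{R}$. For $g\in\mathcal{G}$ let $f_g(x)=\int p_\theta(x)\,\mathrm{d}g(\theta)$. The observations $X_1,\dots,X_n$ are i.i.d. with density $f_{g_0}$ (with respect to $\mu$) for some $g_0\in\mathcal{G}$. Notation. $|X|_n=\max_{1\le i\le n}|X_i|$; $\ell_n(f)=\sum_{i=1}^n\log f(X_i)$; $a\vee b=\max(a,b)$, $a\wedge b=\min(a,b)$. The NPMLE $\hat g$ is any maximizer of $\ell_n(f_g)$ over $g\in\mathcal{G}$. An approximate NPMLE $\tilde g$ is a data-dependent element of $\mathcal{G}$. The squared Hellinger distance between densities $f,f_0$ with respect to $\mu$ is $H^2(f,f_0)=\int(\sqrt{f(x)}-\sqrt{f_0(x)})^2\,\mathrm{d}\mu(x)$. The constants $\alpha_1,\alpha_2,c_0,c_1,c_2$ are regarded as attached to $p_0$, and $\beta_0,b_0,b_1$ as attached to $(p_0,g_0)$, so constants depending on $p_0$, $g_0$ may depend on them. *)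

(* Defs.v *)
From HB Require Import structures.
From mathcomp Require Import all_boot all_order all_algebra finmap.
From mathcomp Require Import all_classical all_reals all_analysis.

Set Implicit Arguments.
Unset Strict Implicit.
Unset Printing Implicit Defensive.

Import Order.TTheory GRing.Theory Num.Theory.
Import numFieldNormedType.Exports.

Local Open Scope classical_set_scope.
Local Open Scope ring_scope.

Definition is_density (R : realType)
    (mu : {measure set (measurableTypeR R) -> \bar R}) (p : R -> R) : Prop :=
  [/\ measurable_fun [set: measurableTypeR R] p,
      forall x, 0 <= p x
    & (\int[mu]_x (p x)%:E = 1)%E].

(* [Z], possibly [+oo]; the set Theta is [[set theta | Z theta < +oo]]. *)
Definition partition_function (R : realType)
    (mu : {measure set (measurableTypeR R) -> \bar R}) (p0 : R -> R)
    (theta : R) : \bar R :=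
  (\int[mu]_x (expR (theta * x) * p0 x)%:E)%E.

Definition natural_parameters (R : realType)
    (mu : {measure set (measurableTypeR R) -> \bar R}) (p0 : R -> R) : set R :=
  [set theta | (partition_function mu p0 theta < +oo)%E].

(* Meaningful on [natural_parameters mu p0], where [Z] is finite. *)
Definition kappa (R : realType)
    (mu : {measure set (measurableTypeR R) -> \bar R}) (p0 : R -> R)
    (theta : R) : R :=
  ln (fine (partition_function mu p0 theta)).

Definition expfam (R : realType)
    (mu : {measure set (measurableTypeR R) -> \bar R}) (p0 : R -> R)
    (theta x : R) : R :=
  expR (theta * x - kappa mu p0 theta) * p0 x.

(* The integral is taken as a real number.  Nothing is lost when [kappa] is
   superlinear at infinity: [theta * x - kappa theta] is then bounded above in
   [theta], so the integral is finite for every [g] and [x]. *)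
Definition mixture (R : realType)
    (mu : {measure set (measurableTypeR R) -> \bar R}) (p0 : R -> R)
    (g : probability (measurableTypeR R) R) (x : R) : R :=
  \int[g]_theta expfam mu p0 theta x.

(* [lne 0 = -oo], so that a vanishing density has log-likelihood [-oo]. *)
Definition loglik (R : realType) (n : nat)
    (x : n.-tuple (measurableTypeR R)) (f : R -> R) : \bar R :=
  (\sum_(i < n) lne (f (tnth x i))%:E)%E.

Definition is_npmle (R : realType)
    (mu : {measure set (measurableTypeR R) -> \bar R}) (p0 : R -> R) (n : nat)
    (x : n.-tuple (measurableTypeR R))
    (ghat : probability (measurableTypeR R) R) : Prop :=
  forall g : probability (measurableTypeR R) R,
    (loglik x (mixture mu p0 g) <= loglik x (mixture mu p0 ghat))%E.

Definition hellinger2 (R : realType)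
    (mu : {measure set (measurableTypeR R) -> \bar R}) (f f0 : R -> R) : \bar R :=
  (\int[mu]_x ((Num.sqrt (f x) - Num.sqrt (f0 x)) ^+ 2)%:E)%E.

Definition absmax (R : realType) (n : nat)
    (x : n.-tuple (measurableTypeR R)) : R :=
  \big[Num.max/0]_(i < n) `|tnth x i|.

Definition mutually_independent (R : realType) (d : measure_display)
    (Omega : measurableType d) (P : probability Omega R)
    (X : nat -> {RV P >-> measurableTypeR R}) : Prop :=
  forall (I : {fset nat}) (A : nat -> set (measurableTypeR R)),
    (forall i, measurable (A i)) ->
    P (\bigcap_(i in [set` I]) (X i @^-1` A i)) =
    (\prod_(i <- I) P (X i @^-1` A i))%E.

Definition iid_density (R : realType)
    (mu : {measure set (measurableTypeR R) -> \bar R}) (f : R -> R)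
    (d : measure_display) (Omega : measurableType d) (P : probability Omega R)
    (X : nat -> {RV P >-> measurableTypeR R}) : Prop :=
  mutually_independent X /\
  forall (i : nat) (A : set (measurableTypeR R)), measurable A ->
    distribution P (X i) A = (\int[mu]_(x in A) (f x)%:E)%E.

Definition sample (R : realType) (d : measure_display)
    (Omega : measurableType d) (P : probability Omega R)
    (X : nat -> {RV P >-> measurableTypeR R}) (n : nat) (w : Omega) :
    n.-tuple (measurableTypeR R) :=
  [tuple X i w | i < n].

(* Main.v *)
Require Import Defs.
From HB Require Import structures.
From mathcomp Require Import all_boot all_order all_algebra finmap.
From mathcomp Require Import all_classical all_reals all_analysis.
From mathcomp Require Import measurable_realfun ring lra.

(** Writing [h_g] for the density of the mixture [f_g] with respect to [p0 mu],
    one has [f_g = h_g p0], and [p0] integrates to one. Zero mean gives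
    [kappa >= 0] by Jensen, and the superlinear lower bound on [kappa] makes the
    parameters [|theta| >= T], with [T] of order [B ^ alpha1], negligible in
    [h_g x] as soon as [|x| <= B]. On [|theta| <= T] the exponential is replaced
    by its Taylor polynomial of degree of order [T B], so that [h_g] on
    [[-B, B]] is determined, up to [eta] of order [n ^ -2], by finitely many
    truncated moments of [g]; rounding them splits all mixing distributions
    into [exp (O ((T B) ^ 2))] cells. If an approximate maximizer of
    the likelihood lies in the same cell as some [g] with [H^2(f_g, f_g0) >= D],
    then [prod_i ((h_g + eta) / h_g0) (X_i) >= exp (- a)] when all [|X_i| <= B]; by
    Markov's inequality applied to the square root of the product, and by
    independence, this has probability at most
    [exp (a / 2 + n (sqrt eta - D / 2))]. A union bound over the cells and the
    tail bound for [max_i |X_i|], with [B ^ (1 + alpha1)] of order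
    [sqrt t (log n) ^ (gamma0 / 2)], conclude. *)

Set Implicit Arguments.
Unset Strict Implicit.
Unset Printing Implicit Defensive.

Import Order.TTheory GRing.Theory Num.Theory.
Import numFieldNormedType.Exports.

Local Open Scope classical_set_scope.
Local Open Scope ring_scope.

Section density_measure.
Local Open Scope ereal_scope.
Context d (T : measurableType d) (R : realType).
Variables (mu : {measure set T -> \bar R}) (p : T -> R).

Definition density_measure
    (mp : measurable_fun [set: T] p) (p_ge0 : forall x, (0 <= p x)%R)
    (A : set T) : \bar R :=
  \int[mu]_(x in A) (p x)%:E.

Hypothesis mp : measurable_fun [set: T] p.
Hypothesis p_ge0 : forall x, (0 <= p x)%R.

Local Notation m := (density_measure mp p_ge0).

Let density_measure0 : m set0 = 0.
Proof. exact: integral_set0. Qed.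

Let density_measure_ge0 A : 0 <= m A.
Proof. by apply: integral_ge0 => x _; rewrite lee_fin. Qed.

Let density_measure_sigma_additive : semi_sigma_additive m.
Proof.
move=> A mA tA mUA; rewrite /density_measure ge0_integral_bigcup//.
- apply: is_cvg_ereal_nneg_natsum_cond => n _ _.
  exact: density_measure_ge0.
- by apply/measurable_EFinP/measurable_funTS.
- by move=> x _; rewrite lee_fin.
Qed.

HB.instance Definition _ := isMeasure.Build _ _ _ m
  density_measure0 density_measure_ge0 density_measure_sigma_additive.

Import HBNNSimple.

Lemma ge0_integral_density (f : T -> \bar R) :
  measurable_fun [set: T] f -> (forall x, 0 <= f x) ->
  \int[m]_x f x = \int[mu]_x (f x * (p x)%:E).
Proof.
move=> mf f0; pose h := nnsfun_approx measurableT mf.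
have h_nd x : {homo (fun n => (h n x)%:E) : a b / (a <= b)%N >-> a <= b}.
  by move=> a b ab; rewrite lee_fin; exact/lefP/nd_nnsfun_approx.
have h_cvg x : (h n x)%:E @[n --> \oo] --> f x.
  by apply: cvg_nnsfun_approx.
have mpE : measurable_fun [set: T] (fun x => (p x)%:E) by exact/measurable_EFinP.
transitivity (limn (fun n => \int[m]_x (h n x)%:E)).
  rewrite -monotone_convergence//.
  - by apply: eq_integral => x _; apply/esym/cvg_lim => //; exact: h_cvg.
  - by move=> n; exact/measurable_EFinP.
  - by move=> n x _; rewrite lee_fin.
transitivity (limn (fun n => \int[mu]_x ((h n x)%:E * (p x)%:E))); last first.
  rewrite -monotone_convergence//.
  - apply: eq_integral => x _; apply/cvg_lim => //.
    by under eq_fun do rewrite muleC; rewrite muleC; apply: cvgeZl.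
  - by move=> n; apply: emeasurable_funM => //; exact/measurable_EFinP.
  - by move=> n x _; rewrite mule_ge0// lee_fin.
  - by move=> x _ a b ab; rewrite lee_wpmul2r ?lee_fin//; exact/lefP/nd_nnsfun_approx.
congr (limn _); apply/funext => n.
transitivity (\int[m]_x
   (\sum_(y \in range (h n)) (y * \1_(h n @^-1` [set y]) x)%:E)).
  by apply: eq_integral => t _; rewrite /= fimfunE -fsumEFin.
have mind r : measurable_fun [set: T] (fun x => (r * \1_(h n @^-1` [set r]) x)%:E).
  by apply: (measurable_comp measurableT) => //; exact: measurable_funM.
rewrite ge0_integral_fsum//; last by move=> y x _; exact: nnfun_muleindic_ge0.
transitivity (\int[mu]_x (\sum_(y \in range (h n))
    (y * \1_(h n @^-1` [set y]) x)%:E * (p x)%:E)); last first.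
  apply: eq_integral => x _.
  rewrite -ge0_mule_fsuml => [|y]; last exact: nnfun_muleindic_ge0.
  by rewrite fsumEFin // -(fimfunE _ x).
rewrite ge0_integral_fsum//; last 2 first.
  - by move=> y; exact: emeasurable_funM.
  - by move=> y x _; rewrite mule_ge0 ?lee_fin// -lee_fin nnfun_muleindic_ge0.
apply: eq_fsbigr => r; rewrite inE => -[t _ rE].
have r0 : (0 <= r)%R by rewrite -rE.
under eq_integral do rewrite EFinM.
rewrite integralZl_indic_nnsfun => //.
under [RHS]eq_integral do rewrite EFinM -muleA.
rewrite ge0_integralZl//.
- congr (_ * _); rewrite integral_indic// setIT.
  rewrite -[LHS]/(\int[mu]_(x in h n @^-1` [set r]) (p x)%:E) integral_mkcond.
  by apply: eq_integral => x _; rewrite epatch_indic muleC.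
- by apply: emeasurable_funM => //; exact/measurable_EFinP.
- by move=> x _; rewrite mule_ge0// lee_fin.
Qed.

End density_measure.

Section independence.
Local Open Scope ereal_scope.
Context d d' (Omega : measurableType d) (T : measurableType d') (R : realType).

(* Both sides are integrals of [f] against the same measure on [T], by
   hypothesis: the image under [X] of the measure with density [Y], and the
   image of [P] scaled by [c]. *)
Lemma ge0_integral_uncorrelated (P : {measure set Omega -> \bar R})
    (X : {mfun Omega >-> T}) (Y : Omega -> R) (c : {nonneg R}) (f : T -> R) :
  measurable_fun [set: Omega] Y ->
  (forall w, (0 <= Y w)%R) ->
  measurable_fun [set: T] f -> (forall x, (0 <= f x)%R) ->
  (forall A, measurable A ->
     \int[P]_w ((\1_A (X w))%:E * (Y w)%:E) = c%:num%:E * P (X @^-1` A)) ->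
  \int[P]_w ((f (X w))%:E * (Y w)%:E) = c%:num%:E * \int[P]_w (f (X w))%:E.
Proof.
move=> mY Y0 mf f0 H.
have mX : measurable_fun [set: Omega] X by [].
have mfE : measurable_fun [set: T] (EFin \o f) by exact/measurable_EFinP.
pose Q := density_measure P mY Y0 : {measure set Omega -> \bar R}.
have -> : \int[P]_w ((f (X w))%:E * (Y w)%:E) = \int[Q]_w (f (X w))%:E.
  rewrite ge0_integral_density// => [|w]; last by rewrite lee_fin.
  by apply/measurable_EFinP; exact: measurableT_comp.
have f0E : {in [set: T], forall x, 0 <= (EFin \o f) x}.
  by move=> x _; rewrite lee_fin.
rewrite -[LHS](ge0_integral_pushforward mX Q measurableT mfE f0E).
rewrite -[in RHS](ge0_integral_pushforward mX P measurableT mfE f0E).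
rewrite -ge0_integral_mscale//; last by move=> x _; rewrite lee_fin.
apply: eq_measure_integral => A mA _.
have mXA : measurable (X @^-1` A) by rewrite -[X in measurable X]setTI; exact: mX.
transitivity (c%:num%:E * P (X @^-1` A)); last by [].
rewrite -(H _ mA) /Q /= /pushforward /= /density_measure integral_mkcond.
by apply: eq_integral => w _; rewrite epatch_indic muleC.
Qed.

End independence.

Lemma measurable_bigprod d (T : measurableType d) (R : realType) (D : set T)
    (I : Type) (s : seq I) (Q : pred I) (h : I -> T -> R) :
  (forall i, Q i -> measurable_fun D (h i)) ->
  measurable_fun D (fun x => \prod_(i <- s | Q i) h i x).
Proof.
move=> mh; elim: s => [|i s IH].
  by under eq_fun do rewrite big_nil; exact: measurable_cst.
have [Qi|/negbTE Qi] := boolP (Q i); last first.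
  by under eq_fun do rewrite big_cons Qi.
under eq_fun do rewrite big_cons Qi.
by apply: measurable_funM => //; exact: mh.
Qed.

Section product_expectation.
Local Open Scope ereal_scope.
Context d (Omega : measurableType d) (R : realType) (P : probability Omega R).
Variable X : nat -> {RV P >-> measurableTypeR R}.
Hypothesis indepX : mutually_independent X.

Lemma independent_preimages n (A : nat -> set R) :
  (forall i, measurable (A i : set (measurableTypeR R))) ->
  P (\bigcap_(i in `I_n) (X i @^-1` A i)) = \prod_(i < n) P (X i @^-1` A i).
Proof.
move=> mA; have := indepX [fset i | i in iota 0 n]%fset mA.
rewrite (_ : [set` _] = `I_n); last first.
  by apply/seteqP; split=> i /=; rewrite !inE/= mem_iota add0n.
move=> ->; rewrite big_imfset//= undup_id; last exact: iota_uniq.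
by rewrite -(big_mkord xpredT (fun i => P (X i @^-1` A i))) /index_iota subn0.
Qed.

Lemma expectation_prod_independent n (f : nat -> R -> R) :
  (forall i, measurable_fun [set: measurableTypeR R] (f i)) ->
  (forall i x, (0 <= f i x)%R) ->
  (forall i, \int[P]_w (f i (X i w))%:E < +oo) ->
  \int[P]_w (\prod_(i < n) f i (X i w))%R%:E =
  \prod_(i < n) \int[P]_w (f i (X i w))%:E.
Proof.
move=> mf f0 foo.
pose F k (A : nat -> set R) i : measurableTypeR R -> R :=
  if (i < k)%N then f i else \1_(A i).
have mF k A i : (forall i, measurable (A i : set (measurableTypeR R))) ->
    measurable_fun [set: measurableTypeR R] (F k A i).
  by move=> mA; rewrite /F; case: ifP.
have F0 k A i x : (0 <= F k A i x)%R by rewrite /F; case: ifP.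
have mXp i A : measurable (A : set (measurableTypeR R)) ->
    measurable (X i @^-1` A).
  by move=> mA; rewrite -[X in measurable X]setTI; exact: measurable_funP.
have PXE i A : measurable (A : set (measurableTypeR R)) ->
    \int[P]_w (\1_A (X i w))%:E = P (X i @^-1` A).
  move=> mA; rewrite (_ : (fun w => _) = (fun w => (\1_(X i @^-1` A) w)%:E))//.
  by rewrite integral_indic// ?setIT//; exact: mXp.
have Fi k A i : (forall i, measurable (A i : set (measurableTypeR R))) ->
    \int[P]_w (F k A i (X i w))%:E \is a fin_num.
  move=> mA; rewrite ge0_fin_numE; last first.
    by apply: integral_ge0 => w _; rewrite lee_fin.
  rewrite /F; case: ifP => // _.
  rewrite PXE//.
  by rewrite (le_lt_trans (probability_le1 _ _))// ?ltry//; exact: mXp.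
suff H k A : (k <= n)%N ->
    (forall i, measurable (A i : set (measurableTypeR R))) ->
    \int[P]_w (\prod_(i < n) F k A i (X i w))%R%:E =
    \prod_(i < n) \int[P]_w (F k A i (X i w))%:E.
  have := H n (fun=> setT) (leqnn n) (fun=> measurableT).
  under eq_integral do under eq_bigr => i _ do rewrite /F ltn_ord.
  by move=> ->; apply: eq_bigr => i _; rewrite /F ltn_ord.
elim: k A => [|k IH] A.
  move=> _ mA; rewrite /F/=.
  transitivity (\int[P]_w (\1_(\bigcap_(i in `I_n) (X i @^-1` A i)) w)%:E).
    apply: eq_integral => w _; congr EFin; rewrite indicE.
    case: (boolP (w \in _)) => /= [|/negP].
      rewrite inE => wA; apply: big1 => i _.
      by rewrite indicE mem_set//; have := wA i (ltn_ord i).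
    rewrite inE => wA; apply/eqP; apply: contra_notT wA => /prodf_neq0 H i /= ni.
    have := H (Ordinal ni) isT; rewrite indicE /=.
    by case: (boolP (X i w \in A i)); [rewrite inE|rewrite eqxx].
  rewrite integral_indic// ?setIT; last first.
    by apply: bigcap_measurableType => i _; exact: mXp.
  apply: (etrans (@independent_preimages n A mA)); apply: eq_bigr => i _.
  by rewrite PXE.
move=> kn mA.
pose k' := Ordinal kn.
pose Y w := (\prod_(i < n | i != k') F k.+1 A i (X i w))%R.
have mY : measurable_fun [set: Omega] Y.
  apply: measurable_bigprod => i _; apply: measurableT_comp => //.
  exact: mF.
have Y0 w : (0 <= Y w)%R by apply: prodr_ge0 => i _.
pose c' := \prod_(i < n | i != k') \int[P]_w (F k.+1 A i (X i w))%:E.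
have c'0 : 0 <= c'.
  apply: prode_ge0 => i _; apply: integral_ge0 => w _; by rewrite lee_fin.
have c'fin : c' \is a fin_num by apply: prode_fin_num => i _; exact: Fi.
pose c := NngNum (fine_ge0 c'0).
have cE : c%:num%:E = c' by rewrite /= fineK.
have Fk x : F k.+1 A k x = f k x by rewrite /F ltnSn.
transitivity (\int[P]_w ((f k (X k w))%:E * (Y w)%:E)).
  by apply: eq_integral => w _; rewrite (bigD1 k')//= Fk EFinM.
rewrite (@ge0_integral_uncorrelated _ _ _ _ _ _ (X k) Y c)//.
  rewrite cE [RHS](bigD1 k')//= muleC; congr (_ * _).
  by apply: eq_integral => w _; rewrite Fk.
move=> B mB; rewrite cE.
pose A' i := if i == k then B else A i.
have mA' i : measurable (A' i : set (measurableTypeR R)).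
  by rewrite /A'; case: ifP.
have FA' i : i != k -> F k A' i = F k.+1 A i.
  move=> ik; rewrite /F /A' (negbTE ik) ltnS.
  by case: ltngtP ik.
have FkA' : F k A' k = \1_B by rewrite /F ltnn /A' eqxx.
have := IH A' (ltnW kn) mA'.
rewrite [X in _ = X -> _](bigD1 k')//= FkA'.
rewrite PXE// muleC => H.
have -> : c' = \prod_(i < n | i != k') \int[P]_w (F k A' i (X i w))%:E.
  apply: eq_bigr => i ik; rewrite FA'//.
rewrite -H; apply: eq_integral => w _.
rewrite -EFinM (bigD1 k')//= FkA'; congr (_ * _)%:E.
by apply: eq_bigr => i ik; rewrite FA'.
Qed.

End product_expectation.

Section bounded_probability.
Context d (T : measurableType d) (R : realType) (P : probability T R).

Lemma bounded_integrable_probability (f : T -> R) (M : R) :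
  measurable_fun [set: T] f -> (forall x, `|f x| <= M) ->
  P.-integrable [set: T] (EFin \o f).
Proof.
move=> mf fM; apply: measurable_bounded_integrable => //.
  by rewrite (le_lt_trans (probability_le1 _ _))// ltry.
exists M; split; first exact: num_real.
by move=> r Mr x _; exact: le_trans (fM x) (ltW Mr).
Qed.

Lemma normr_Rintegral_le (f : T -> R) (M : R) :
  measurable_fun [set: T] f -> (forall x, `|f x| <= M) ->
  `|\int[P]_x f x| <= M.
Proof.
move=> mf fM; have fi := bounded_integrable_probability mf fM.
apply: le_trans (le_normr_Rintegral measurableT fi) _.
have -> : M = \int[P]_x M.
  by rewrite Rintegral_cst// [X in fine X]probability_setT mulr1.
apply: le_Rintegral => //; first exact: integrable_norm.
exact: finite_measure_integrable_cst.
Qed.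

Lemma Rintegral_gt0 (f : T -> R) :
  P.-integrable [set: T] (EFin \o f) -> (forall x, 0 < f x) ->
  0 < \int[P]_x f x.
Proof.
move=> fi f0; rewrite lt0r Rintegral_ge0 ?andbT; last by move=> x _; exact: ltW.
apply/eqP => f0E.
have fin := integrable_fin_num measurableT fi.
have /ae_eq_integral_abs : (\int[P]_x `|(f x)%:E| = 0)%E.
  under eq_integral do rewrite gee0_abs ?lee_fin ?(ltW (f0 _))//.
  by rewrite -(fineK fin); congr EFin.
case=> //; first by case/integrableP : fi.
move=> N [mN PN0 /= sub].
have : P setT = 0%E.
  apply/eqP; rewrite -measure_le0 -PN0; apply: le_measure; rewrite ?inE//.
  move=> x _; apply: sub => /= /(_ I); have := f0 x.
  by move=> + [fx0]; rewrite fx0 ltxx.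
rewrite [X in X = _]probability_setT => -[]; exact/eqP/oner_neq0.
Qed.

End bounded_probability.

Section density_probability.
Local Open Scope ereal_scope.
Context (R : realType).
Variables (mu : {measure set (measurableTypeR R) -> \bar R}) (p : R -> R).

Lemma density_measurable :
  is_density mu p -> measurable_fun [set: measurableTypeR R] p.
Proof. by case. Qed.

Lemma density_ge0 : is_density mu p -> forall x, (0 <= p x)%R.
Proof. by case. Qed.

Definition density_probability (H : is_density mu p)
    (A : set (measurableTypeR R)) : \bar R :=
  density_measure mu (density_measurable H) (density_ge0 H) A.

Variable H : is_density mu p.

HB.instance Definition _ := Measure.copy (density_probability H)
  (density_measure mu (density_measurable H) (density_ge0 H)).

Let density_probability_setT : density_probability H setT = 1.
Proof. by case: (H). Qed.

HB.instance Definition _ := Measure_isProbability.Build _ _ _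
  (density_probability H) density_probability_setT.

Lemma ge0_integral_density_probability (f : R -> \bar R) :
  measurable_fun [set: measurableTypeR R] f -> (forall x, 0 <= f x) ->
  \int[density_probability H]_x f x = \int[mu]_x (f x * (p x)%:E).
Proof.
move=> mf f0.
rewrite -(ge0_integral_density mu (density_measurable H) (density_ge0 H) mf f0).
exact: eq_measure_integral.
Qed.

End density_probability.

Section exponential_family.
Local Open Scope ereal_scope.
Context (R : realType).
Variables (mu : {measure set (measurableTypeR R) -> \bar R}) (p0 : R -> R).
Hypothesis p0_density : is_density mu p0.
Hypothesis Theta_full : natural_parameters mu p0 = [set: R].
Hypothesis p0_mean_zero : \int[mu]_x (x * p0 x)%:E = 0.

Local Notation P0 := (density_probability p0_density).
Local Notation Z := (partition_function mu p0).
Local Notation kappa := (kappa mu p0).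

Let mp0 : measurable_fun [set: measurableTypeR R] p0.
Proof. by case: p0_density. Qed.

Let p0_ge0 x : (0 <= p0 x)%R. Proof. by case: p0_density. Qed.

Let int_p0 : \int[mu]_x (p0 x)%:E = 1. Proof. by case: p0_density. Qed.

Lemma measurable_mulr_pair :
  measurable_fun [set: measurableTypeR R * measurableTypeR R]
    (fun z => z.1 * z.2 : R)%R.
Proof. by apply: measurable_funM; [exact: measurable_fst|exact: measurable_snd]. Qed.

Lemma measurable_expR_mulr (theta : R) :
  measurable_fun [set: measurableTypeR R] (fun x : R => expR (theta * x)).
Proof. by apply: measurableT_comp => //; exact: mulrl_measurable. Qed.

Lemma partition_functionE theta :
  Z theta = \int[P0]_x (expR (theta * x))%:E.
Proof.
rewrite /partition_function ge0_integral_density_probability.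
- by apply: eq_integral => x _; rewrite EFinM.
- apply/measurable_EFinP; exact: measurable_expR_mulr.
- by move=> x; rewrite lee_fin expR_ge0.
Qed.

Lemma partition_function_fin_num theta : Z theta \is a fin_num.
Proof.
rewrite ge0_fin_numE; last first.
  by apply: integral_ge0 => x _; rewrite lee_fin mulr_ge0 ?expR_ge0.
have : natural_parameters mu p0 theta by rewrite Theta_full.
by [].
Qed.

Lemma integrable_expR_density theta :
  mu.-integrable [set: measurableTypeR R]
    (fun x => (expR (theta * x) * p0 x)%:E).
Proof.
apply/integrableP; split.
  apply/measurable_EFinP; apply: measurable_funM => //.
  exact: measurable_expR_mulr.
under eq_integral do rewrite gee0_abs ?lee_fin ?mulr_ge0 ?expR_ge0//.
by have := partition_function_fin_num theta; rewrite fin_numE ltey => /andP[].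
Qed.

Lemma integrable_mulr_density :
  mu.-integrable [set: measurableTypeR R] (fun x => (x * p0 x)%:E).
Proof.
have i1 := integrable_expR_density 1; have i2 := integrable_expR_density (-1).
apply: (le_integrable _ _ _ (integrableD measurableT i1 i2)) => //.
  by apply/measurable_EFinP; exact: measurable_funM.
move=> x _; rewrite /= lee_fin normrM (ger0_norm (p0_ge0 x)) mul1r mulN1r.
rewrite -mulrDl [leRHS]ger0_norm ?mulr_ge0 ?addr_ge0 ?expR_ge0//.
rewrite ler_wpM2r//; have := expR_ge1Dx x; have := expR_ge1Dx (- x).
have := expR_ge0 x; have := expR_ge0 (- x).
by case: (ger0P x) => _; lra.
Qed.

Lemma partition_function_ge1 theta : 1 <= Z theta.
Proof.
have i0 : mu.-integrable [set: measurableTypeR R] (fun x => (p0 x)%:E).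
  have := integrable_expR_density 0; apply: eq_integrable => // x _.
  by rewrite mul0r expR0 mul1r.
have i1 := integrableZl measurableT theta integrable_mulr_density.
have -> : 1 = \int[mu]_x ((p0 x)%:E + theta%:E * (x * p0 x)%:E).
  rewrite integralD//= integralZl//; last exact: integrable_mulr_density.
  by rewrite int_p0 p0_mean_zero mule0 adde0.
apply: le_integral => //.
- exact: integrableD.
- exact: integrable_expR_density.
- move=> x _; rewrite -EFinM -EFinD lee_fin.
  have := expR_ge1Dx (theta * x); have := p0_ge0 x.
  by set e := expR _; nra.
Qed.

Lemma expR_kappa theta : (expR (kappa theta))%:E = Z theta.
Proof.
have Z1 := partition_function_ge1 theta.
have Zf := partition_function_fin_num theta.
rewrite /Defs.kappa lnK ?fineK// posrE -lte_fin fineK//.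
exact: lt_le_trans Z1.
Qed.

Lemma kappa_ge0 theta : (0 <= kappa theta)%R.
Proof.
apply: ln_ge0; rewrite -lee_fin fineK ?partition_function_fin_num//.
exact: partition_function_ge1.
Qed.

Lemma measurable_kappa : measurable_fun [set: measurableTypeR R] kappa.
Proof.
apply: measurableT_comp => //; apply: measurableT_comp => //.
rewrite (_ : Z = fun theta => \int[P0]_x (expR (theta * x))%:E); last first.
  by apply/funext => theta; exact: partition_functionE.
apply: (measurable_fun_fubini_tonelli_F (m2 := P0)
  (fun z : measurableTypeR R * measurableTypeR R => (expR (z.1 * z.2))%:E)).
- apply/measurable_EFinP; apply: measurableT_comp => //.
  exact: measurable_mulr_pair.
- by move=> z; rewrite lee_fin expR_ge0.
Qed.

End exponential_family.

Definition tilt (R : realType) (mu : {measure set (measurableTypeR R) -> \bar R})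
    (p0 : R -> R) (theta x : R) : R :=
  expR (theta * x - kappa mu p0 theta).

(* The density of the mixture with respect to [p0 mu] instead of [mu]. *)
Definition tilt_mixture (R : realType)
    (mu : {measure set (measurableTypeR R) -> \bar R}) (p0 : R -> R)
    (g : probability (measurableTypeR R) R) (x : R) : R :=
  \int[g]_theta tilt mu p0 theta x.

Definition tilt_cutoff (R : realType)
    (mu : {measure set (measurableTypeR R) -> \bar R}) (p0 : R -> R)
    (B T : R) : Prop :=
  forall theta x, `|x| <= B -> T <= `|theta| ->
    theta * x - kappa mu p0 theta <= - (T * B).

Lemma superlinear_tilt_cutoff (R : realType)
    (mu : {measure set (measurableTypeR R) -> \bar R}) (p0 : R -> R)
    (alpha c0 c1 B T : R) :
  0 < alpha -> 0 < c0 -> 0 < c1 ->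
  (forall theta, c0 <= `|theta| ->
     c1 * `|theta| `^ (1 + alpha^-1) <= kappa mu p0 theta) ->
  0 <= B -> c0 <= T -> 2 * B <= c1 * T `^ alpha^-1 ->
  tilt_cutoff mu p0 B T.
Proof.
move=> a0 c00 c10 kg B0 cT TB theta x xB Tt.
have T0 : 0 < T by lra.
have t0 : 0 < `|theta| by lra.
have := kg theta (le_trans cT Tt).
rewrite powRD; last by rewrite gt_eqF ?addr_gt0 ?invr_gt0.
rewrite powRr1 ?normr_ge0// => kt.
have H : T `^ alpha^-1 <= `|theta| `^ alpha^-1.
  by rewrite ge0_ler_powR ?nnegrE ?invr_ge0 ?(ltW a0) ?(ltW T0).
have H2 : 2 * B <= c1 * `|theta| `^ alpha^-1.
  by apply: le_trans TB _; rewrite ler_pM2l.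
have H3 : theta * x <= `|theta| * B.
  apply: le_trans (ler_norm _) _; rewrite normrM ler_wpM2l//.
have H4 : `|theta| * (2 * B) <= kappa mu p0 theta.
  apply: le_trans kt; rewrite [leRHS]mulrCA ler_wpM2l//.
have H5 : T * B <= `|theta| * B by rewrite ler_wpM2r.
lra.
Qed.

Lemma measurable_fun_sqrt d (T : measurableType d) (R : realType) (D : set T)
    (f : T -> R) :
  measurable_fun D f -> measurable_fun D (fun x => Num.sqrt (f x)).
Proof.
apply: measurableT_comp; apply: continuous_measurable_fun.
exact: sqrt_continuous.
Qed.

Section tilt_mixture.
Local Open Scope ereal_scope.
Context (R : realType).
Variables (mu : {measure set (measurableTypeR R) -> \bar R}) (p0 : R -> R).
Hypothesis p0_density : is_density mu p0.
Hypothesis Theta_full : natural_parameters mu p0 = [set: R].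
Hypothesis p0_mean_zero : \int[mu]_x (x * p0 x)%:E = 0.
Hypothesis cutoff : forall B : R, (0 <= B)%R ->
  exists2 T : R, (0 <= T)%R & tilt_cutoff mu p0 B T.

Local Notation P0 := (density_probability p0_density).
Local Notation kappa := (kappa mu p0).
Local Notation w := (tilt mu p0).
Local Notation h := (tilt_mixture mu p0).

Lemma tilt_gt0 theta x : (0 < w theta x)%R. Proof. exact: expR_gt0. Qed.

Lemma tilt_le B T theta x : (0 <= T)%R -> tilt_cutoff mu p0 B T ->
  (`|x| <= B)%R -> (w theta x <= expR (T * B))%R.
Proof.
move=> T0 cTB xB; rewrite ler_expR.
have B0 : (0 <= B)%R by exact: le_trans xB.
have [tT|Tt] := leP T `|theta|%R.
  have := cTB theta x xB tT.
  have : (0 <= T * B)%R by exact: mulr_ge0.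
  by lra.
have := kappa_ge0 p0_density Theta_full p0_mean_zero theta.
have : (theta * x <= T * B)%R.
  by apply: le_trans (ler_norm _) _; rewrite normrM ler_pM// ltW.
by lra.
Qed.

Lemma measurable_tilt_pair :
  measurable_fun [set: measurableTypeR R * measurableTypeR R]
    (fun z => w z.1 z.2).
Proof.
apply: measurableT_comp => //; apply: measurable_funB.
  exact: measurable_mulr_pair.
exact: measurableT_comp (measurable_kappa p0_density) measurable_fst.
Qed.

Lemma measurable_tilt x :
  measurable_fun [set: measurableTypeR R] (w ^~ x).
Proof.
apply: measurableT_comp => //; apply: measurable_funB.
  exact: mulrr_measurable.
exact: measurable_kappa p0_density.
Qed.

Lemma tilt_bounded x : exists M : R, forall theta, (`|w theta x| <= M)%R.
Proof.
have [T T0 cT] := cutoff (normr_ge0 x).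
exists (expR (T * `|x|)) => theta.
by rewrite ger0_norm ?expR_ge0//; exact: tilt_le cT _.
Qed.

Lemma integrable_tilt (g : probability (measurableTypeR R) R) x :
  g.-integrable [set: measurableTypeR R] (EFin \o (w ^~ x)).
Proof.
have [M wM] := tilt_bounded x.
exact: bounded_integrable_probability (measurable_tilt x) wM.
Qed.

Lemma tilt_mixture_gt0 g x : (0 < h g x)%R.
Proof.
by apply: Rintegral_gt0 => [|theta]; [exact: integrable_tilt|exact: tilt_gt0].
Qed.

Lemma mixtureE g x : mixture mu p0 g x = (h g x * p0 x)%R.
Proof. by rewrite -RintegralZr//; exact: integrable_tilt. Qed.

Lemma EFin_tilt_mixture g x : (h g x)%:E = \int[g]_theta (w theta x)%:E.
Proof.
rewrite /tilt_mixture /Rintegral fineK//.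
by have := integrable_fin_num measurableT (integrable_tilt g x).
Qed.

Lemma measurable_tilt_mixture_family d (Omega : measurableType d)
    (G : Omega -> pprobability (measurableTypeR R) R) :
  measurable_fun [set: Omega] G ->
  measurable_fun [set: Omega * measurableTypeR R] (fun z => h (G z.1) z.2).
Proof.
move=> mG; apply/measurable_EFinP.
rewrite (_ : EFin \o _ = (fun z => \int[G z.1]_theta (w theta z.2)%:E)); last first.
  by apply/funext => z; exact: EFin_tilt_mixture.
have mG1 : measurable_fun [set: Omega * measurableTypeR R] (G \o fst).
  exact: measurableT_comp.
apply: (@measurable_fun_integral_finite_kernel _ _
  (Omega * measurableTypeR R)%type (measurableTypeR R) R
  (fun z : (Omega * measurableTypeR R) * measurableTypeR R =>
     (w z.2 z.1.2)%:E) (kprobability mG1)).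
- by move=> z; rewrite lee_fin expR_ge0.
- apply/measurable_EFinP.
  apply: (@measurableT_comp _ _ _ _ _ _ (fun z => w z.1 z.2) _
    (fun z : (Omega * measurableTypeR R) * measurableTypeR R => (z.2, z.1.2))).
    exact: measurable_tilt_pair.
  apply: measurable_fun_pair => //.
  exact: measurableT_comp.
Qed.

Lemma measurable_tilt_mixture (g : probability (measurableTypeR R) R) :
  measurable_fun [set: measurableTypeR R] (h g).
Proof.
have := @measurable_tilt_mixture_family _ unit
  (fun=> g : pprobability (measurableTypeR R) R) (@measurable_cst _ _ _ _ _ _).
move=> mh.
exact: (measurableT_comp mh (measurable_pair1 tt)).
Qed.

Lemma integral_tilt theta : \int[P0]_x (w theta x)%:E = 1.
Proof.
transitivity (\int[P0]_x ((expR (- kappa theta))%:E * (expR (theta * x))%:E)).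
  by apply: eq_integral => x _; rewrite -EFinM -expRD addrC.
rewrite ge0_integralZl//; last first.
  by apply/measurable_EFinP; exact: measurable_expR_mulr.
rewrite -partition_functionE -(expR_kappa p0_density Theta_full p0_mean_zero).
by rewrite -EFinM -expRD addNr expR0.
Qed.

Lemma integral_tilt_mixture (g : probability (measurableTypeR R) R) :
  \int[P0]_x (h g x)%:E = 1.
Proof.
under eq_integral do rewrite EFin_tilt_mixture.
rewrite -(fubini_tonelli (m1 := g) (m2 := P0) (fun z => (w z.1 z.2)%:E)).
- under eq_integral do rewrite integral_tilt.
  by rewrite integral_cst// mul1e; exact: probability_setT.
- by apply/measurable_EFinP; exact: measurable_tilt_pair.
- by move=> z; rewrite lee_fin expR_ge0.
Qed.

Lemma hellinger2_mixtureE (g g' : probability (measurableTypeR R) R) :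
  hellinger2 mu (mixture mu p0 g) (mixture mu p0 g') =
  \int[P0]_x ((Num.sqrt (h g x) - Num.sqrt (h g' x)) ^+ 2)%:E.
Proof.
have mh k := measurable_tilt_mixture k.
rewrite /hellinger2 ge0_integral_density_probability.
- apply: eq_integral => x _; rewrite !mixtureE -EFinM; congr EFin.
  have p00 := density_ge0 p0_density x.
  rewrite !sqrtrM ?(ltW (tilt_mixture_gt0 _ _))// -mulrBl exprMn.
  by rewrite sqr_sqrtr.
- apply/measurable_EFinP; apply: measurable_funX; apply: measurable_funB.
    exact: (measurable_fun_sqrt (mh g)).
  exact: (measurable_fun_sqrt (mh g')).
- by move=> x; rewrite lee_fin sqr_ge0.
Qed.

Lemma measurable_hellinger2_mixture d (Omega : measurableType d)
    (G : Omega -> pprobability (measurableTypeR R) R)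
    (g : probability (measurableTypeR R) R) :
  measurable_fun [set: Omega] G ->
  measurable_fun [set: Omega]
    (fun u => hellinger2 mu (mixture mu p0 (G u)) (mixture mu p0 g)).
Proof.
move=> mG.
under eq_fun do rewrite hellinger2_mixtureE.
apply: (measurable_fun_fubini_tonelli_F (m2 := P0)
  (fun z : Omega * measurableTypeR R =>
    ((Num.sqrt (h (G z.1) z.2) - Num.sqrt (h g z.2)) ^+ 2)%:E)).
- apply/measurable_EFinP; apply: measurable_funX; apply: measurable_funB.
    apply: measurable_fun_sqrt; exact: measurable_tilt_mixture_family mG.
  apply: measurable_fun_sqrt; apply: measurableT_comp measurable_snd.
  exact: measurable_tilt_mixture.
- by move=> z; rewrite lee_fin sqr_ge0.
Qed.

End tilt_mixture.

Section exponential_series.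
Context (R : realType).
Implicit Types x y Y : R.

Lemma series_exp_coeff_le x n : 0 <= x -> series (exp_coeff x) n <= expR x.
Proof.
move=> x0; apply: nondecreasing_cvgn_le; last exact: is_cvg_series_exp_coeff.
apply/nondecreasing_seqP => k; rewrite seriesSr lerDl; exact: exp_coeff_ge0.
Qed.

Lemma exp_coeff_le_expR x n : 0 <= x -> exp_coeff x n <= expR x.
Proof.
move=> x0; apply: le_trans (series_exp_coeff_le n.+1 x0).
rewrite seriesSr lerDr; apply: sumr_ge0 => k _; exact: exp_coeff_ge0.
Qed.

(* Exponential Markov bound on the tail of the series: for [N <= k],
   [1 <= expR (k - N)], and [expR k * Y ^ k = (expR 1 * Y) ^ k]. *)
Lemma expR_taylor_bound y Y N : `|y| <= Y ->
  `|expR y - \sum_(k < N) y ^+ k / k`!%:R| <= expR (expR 1 * Y - N%:R).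
Proof.
move=> yY.
have Y0 : 0 <= Y by exact: le_trans yY.
have tail M : (N <= M)%N ->
    `|series (exp_coeff y) M - series (exp_coeff y) N| <=
    expR (expR 1 * Y - N%:R).
  move=> NM; rewrite /series /= sub_series_geq//.
  apply: le_trans (ler_norm_sum _ _ _) _.
  apply: (@le_trans _ _
      (\sum_(N <= k < M) expR (- N%:R) * exp_coeff (expR 1 * Y) k)).
    rewrite big_nat_cond [leRHS]big_nat_cond; apply: ler_sum => k.
    rewrite andbT => /andP[Nk _]; rewrite /exp_coeff /= normrM normfV.
    rewrite normrX (ger0_norm (ler0n _ _)) mulrA ler_wpM2r ?invr_ge0//.
    rewrite exprMn -expRM_natl mulr1 mulrA -expRD.
    rewrite -[leLHS]mul1r ler_pM ?exprn_ge0//; last by rewrite lerXn2r ?nnegrE.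
    by rewrite -[leLHS]expR0 ler_expR addrC subr_ge0 ler_nat.
  rewrite -mulr_sumr addrC expRD ler_wpM2l ?expR_ge0//.
  apply: le_trans (series_exp_coeff_le M (mulr_ge0 (expR_ge0 1) Y0)).
  rewrite /series /= [leRHS](big_cat_nat (leq0n N) NM)//= lerDr.
  by apply: sumr_ge0 => k _; apply: exp_coeff_ge0; rewrite mulr_ge0 ?expR_ge0.
have -> : \sum_(k < N) y ^+ k / k`!%:R = series (exp_coeff y) N.
  by rewrite /series /= big_mkord.
have cv : `|series (exp_coeff y) M - series (exp_coeff y) N| @[M --> \oo]
    --> `|expR y - series (exp_coeff y) N|.
  apply: cvg_norm; apply: cvgB; last exact: cvg_cst.
  exact: is_cvg_series_exp_coeff.
rewrite -(cvg_lim _ cv)//; apply: limr_le; first by apply/cvg_ex; eexists; exact: cv.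
by near=> M; apply: tail; near: M; exists N.
Unshelve. all: by end_near. Qed.

Lemma eq_truncn_dist x y : 0 <= x -> 0 <= y ->
  Num.truncn x = Num.truncn y -> `|x - y| <= 1.
Proof.
move=> x0 y0 xy; have /andP[] := truncn_itv x0; have /andP[] := truncn_itv y0.
by rewrite xy -natr1 => ? ? ? ?; rewrite ler_norml; lra.
Qed.

End exponential_series.

Lemma Rintegral_sum d (T : measurableType d) (R : realType)
    (mu : {measure set T -> \bar R}) (I : eqType) (s : seq I) (f : I -> T -> R) :
  (forall i, mu.-integrable [set: T] (EFin \o f i)) ->
  \int[mu]_x (\sum_(i <- s) f i x) = \sum_(i <- s) \int[mu]_x f i x.
Proof.
move=> fi; elim: s => [|i s IH].
  under eq_Rintegral do rewrite big_nil.
  by rewrite big_nil /Rintegral integral0.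
under eq_Rintegral do rewrite big_cons.
rewrite RintegralD//; first by rewrite big_cons IH.
rewrite (_ : EFin \o _ = (fun x => \sum_(i <- s) (f i x)%:E)%E).
  by apply: integrable_sum => // j _; exact: fi.
by apply/funext => x /=; rewrite sumEFin.
Qed.

Section moment_cells.
Context (R : realType).
Variables (mu : {measure set (measurableTypeR R) -> \bar R}) (p0 : R -> R).
Hypothesis p0_density : is_density mu p0.
Hypothesis Theta_full : natural_parameters mu p0 = [set: R].
Hypothesis p0_mean_zero : (\int[mu]_x (x * p0 x)%:E = 0)%E.
Hypothesis cutoff : forall B : R, 0 <= B ->
  exists2 T : R, 0 <= T & tilt_cutoff mu p0 B T.

Variables (B T : R).
Hypothesis B_gt0 : 0 < B.
Hypothesis T_ge0 : 0 <= T.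
Hypothesis cutoffBT : tilt_cutoff mu p0 B T.

Local Notation kappa := (kappa mu p0).
Local Notation h := (tilt_mixture mu p0).
Local Notation proba := (probability (measurableTypeR R) R).

(* The truncated Taylor coefficients, in [x / B], of [x |-> tilt theta x]. *)
Definition tilt_coeff (k : nat) (theta : R) : R :=
  \1_(`[- T, T]) theta * (expR (- kappa theta) * exp_coeff (theta * B) k).

Lemma measurable_tilt_coeff k :
  measurable_fun [set: measurableTypeR R] (tilt_coeff k).
Proof.
apply: measurable_funM.
  by apply: measurable_indic; exact: measurable_itv.
apply: measurable_funM.
  apply: measurableT_comp => //; apply: measurableT_comp => //.
  exact: measurable_kappa p0_density.
apply: measurable_funM => //; apply: measurable_funX.
exact: mulrr_measurable.
Qed.

Lemma tilt_coeff_le k theta : `|tilt_coeff k theta| <= expR (T * B).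
Proof.
rewrite /tilt_coeff indicE mem_setE in_itv /= -ler_norml.
case: (leP `|theta| T) => [tT|_] /=; last by rewrite mul0r normr0 expR_ge0.
rewrite mul1r normrM (ger0_norm (expR_ge0 _)) -[leRHS]mul1r.
apply: ler_pM => //.
  rewrite -[leRHS]expR0 ler_expR oppr_le0.
  exact: kappa_ge0 p0_density Theta_full p0_mean_zero theta.
apply: le_trans (exp_coeff_le_expR k (mulr_ge0 T_ge0 (ltW B_gt0))).
rewrite /exp_coeff /= normrM normfV normrX (ger0_norm (ler0n _ _)).
rewrite ler_wpM2r ?invr_ge0// lerXn2r ?nnegrE ?mulr_ge0 ?(ltW B_gt0)//.
by rewrite normrM (gtr0_norm B_gt0) ler_wpM2r// ltW.
Qed.

Lemma integrable_tilt_coeff (g : proba) k :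
  g.-integrable [set: measurableTypeR R] (EFin \o tilt_coeff k).
Proof.
exact: bounded_integrable_probability (measurable_tilt_coeff k) (tilt_coeff_le k).
Qed.

Lemma tilt_taylor N theta x : `|x| <= B ->
  `|tilt mu p0 theta x - \sum_(k < N) (x / B) ^+ k * tilt_coeff k theta| <=
  expR (expR 1 * (T * B) - N%:R) + expR (- (T * B)).
Proof.
move=> xB; rewrite /tilt_coeff indicE mem_setE in_itv /= -ler_norml.
have [tT|Tt] /= := leP `|theta| T; last first.
  under eq_bigr do rewrite mul0r mulr0.
  rewrite big1// subr0 ger0_norm ?expR_ge0//.
  apply: (@le_trans _ _ (expR (- (T * B)))); last by rewrite lerDr expR_ge0.
  by rewrite ler_expR; apply: cutoffBT => //; exact: ltW.
have -> : \sum_(k < N) (x / B) ^+ k *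
    (1 * (expR (- kappa theta) * exp_coeff (theta * B) k)) =
    expR (- kappa theta) * \sum_(k < N) (theta * x) ^+ k / k`!%:R.
  rewrite mulr_sumr; apply: eq_bigr => k _.
  have -> : theta * x = (x / B) * (theta * B) by field; rewrite gt_eqF.
  by rewrite [(x / B * _) ^+ k]exprMn /exp_coeff /=; ring.
rewrite /tilt (addrC (theta * x)) expRD -mulrBr normrM (ger0_norm (expR_ge0 _)).
apply: (@le_trans _ _ (expR (expR 1 * (T * B) - N%:R))); last first.
  by rewrite lerDl expR_ge0.
rewrite -[leRHS]mul1r ler_pM//.
  rewrite -[leRHS]expR0 ler_expR oppr_le0.
  exact: kappa_ge0 p0_density Theta_full p0_mean_zero theta.
by apply: expR_taylor_bound; rewrite normrM ler_pM.
Qed.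

Lemma tilt_mixture_taylor N (g : proba) x : `|x| <= B ->
  `|h g x - \sum_(k < N) (x / B) ^+ k * \int[g]_theta tilt_coeff k theta| <=
  expR (expR 1 * (T * B) - N%:R) + expR (- (T * B)).
Proof.
move=> xB.
have ci k : g.-integrable [set: measurableTypeR R]
    (EFin \o (fun theta => (x / B) ^+ k * tilt_coeff k theta)).
  exact: (integrableZl measurableT _ (integrable_tilt_coeff g k)).
have -> : \sum_(k < N) (x / B) ^+ k * \int[g]_theta tilt_coeff k theta =
    \int[g]_theta (\sum_(k < N) (x / B) ^+ k * tilt_coeff k theta).
  rewrite Rintegral_sum//.
  apply: eq_bigr => k _; rewrite RintegralZl//; exact: integrable_tilt_coeff.
rewrite -RintegralB//; last 2 first.
- exact: integrable_tilt.
- rewrite (_ : EFin \o _ =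
      (fun theta => \sum_(k < N) ((x / B) ^+ k * tilt_coeff k theta)%:E)%E).
    by apply: integrable_sum => // k _; exact: ci.
  by apply/funext => theta /=; rewrite sumEFin.
apply: normr_Rintegral_le; last by move=> theta; exact: tilt_taylor.
apply: measurable_funB; first exact: measurable_tilt.
apply: measurable_sum => k; apply: measurable_funM => //.
exact: measurable_tilt_coeff.
Qed.

Lemma tilt_mixture_cells (N : nat) (eps : R) : 0 < eps ->
  exists cell : proba ->
      {ffun 'I_N -> 'I_(Num.truncn (2 * expR (T * B) / eps)).+1},
    forall g g', cell g = cell g' -> forall x, `|x| <= B ->
      `|h g x - h g' x| <=
      N%:R * eps + 2 * (expR (expR 1 * (T * B) - N%:R) + expR (- (T * B))).
Proof.
move=> e0; set E := expR (T * B); set M := Num.truncn _.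
pose m (g : proba) k := \int[g]_theta tilt_coeff k theta.
have mE g k : `|m g k| <= E.
  exact: normr_Rintegral_le (measurable_tilt_coeff k) (tilt_coeff_le k).
pose s g k := (m g k + E) / eps.
have s0 g k : 0 <= s g k.
  apply: divr_ge0; last exact: ltW.
  by have := mE g k; rewrite ler_norml => /andP[]; lra.
have sM g k : (Num.truncn (s g k) < M.+1)%N.
  rewrite ltnS; apply: le_truncn; rewrite ler_pM2r ?invr_gt0//.
  by have := mE g k; rewrite ler_norml => /andP[]; lra.
exists (fun g => [ffun k : 'I_N => Ordinal (sM g k)]) => g g' cgg x xB.
have mm (k : 'I_N) : `|m g k - m g' k| <= eps.
  have /(congr1 val) /= H := congr1 (fun f : {ffun _} => f k) cgg.
  move: H; rewrite !ffunE /= => /(eq_truncn_dist (s0 g k) (s0 g' k)).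
  have -> : s g k - s g' k = (m g k - m g' k) / eps by rewrite /s; ring.
  by rewrite normrM normfV (gtr0_norm e0) ler_pdivrMr// mul1r.
have S : `|\sum_(k < N) (x / B) ^+ k * m g k - \sum_(k < N) (x / B) ^+ k * m g' k|
    <= N%:R * eps.
  rewrite -sumrB; apply: le_trans (ler_norm_sum _ _ _) _.
  rewrite mulr_natl -[N in leRHS]card_ord -sumr_const; apply: ler_sum => k _.
  rewrite -mulrBr normrM -[leRHS]mul1r ler_pM// normrX.
  apply: exprn_ile1 => //; rewrite normrM normfV (gtr0_norm B_gt0).
  by rewrite ler_pdivrMr// mul1r.
have t k : `|h k x - \sum_(i < N) (x / B) ^+ i * m k i| <=
    expR (expR 1 * (T * B) - N%:R) + expR (- (T * B)).
  exact: tilt_mixture_taylor.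
move: S (t g) (t g'); rewrite !ler_norml.
by move=> /andP[? ?] /andP[? ?] /andP[? ?]; lra.
Qed.

End moment_cells.

Lemma sqrtr_affinity_le (R : realType) (a b eta : R) :
  0 <= a -> 0 <= b -> 0 <= eta ->
  Num.sqrt (a + eta) * Num.sqrt b + (Num.sqrt a - Num.sqrt b) ^+ 2 / 2 <=
  (a + b) / 2 + Num.sqrt eta * ((1 + b) / 2).
Proof.
move=> a0 b0 e0.
have H : Num.sqrt (a + eta) <= Num.sqrt a + Num.sqrt eta.
  rewrite -[leRHS]ger0_norm ?addr_ge0 ?sqrtr_ge0// -sqrtr_sqr ler_sqrt ?sqr_ge0//.
  rewrite sqrrD !sqr_sqrtr//.
  have : 0 <= Num.sqrt a * Num.sqrt eta by rewrite mulr_ge0 ?sqrtr_ge0.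
  lra.
have Ea := sqr_sqrtr a0; have Eb := sqr_sqrtr b0.
have e1 := sqrtr_ge0 eta; have b1 := sqrtr_ge0 b.
set sa := Num.sqrt a in H Ea *; set sb := Num.sqrt b in Eb b1 *.
set se := Num.sqrt eta in H e1 *; set s := Num.sqrt (a + eta) in H *.
rewrite -Ea -Eb.
have H1 : s * sb <= (sa + se) * sb by rewrite ler_wpM2r.
have H2 : se * sb <= se * ((1 + sb ^+ 2) / 2).
  rewrite ler_wpM2l//; have := sqr_ge0 (sb - 1); rewrite sqrrB1; lra.
lra.
Qed.

Section likelihood_ratio.
Local Open Scope ereal_scope.
Context (R : realType).
Variables (mu : {measure set (measurableTypeR R) -> \bar R}) (p0 : R -> R).
Hypothesis p0_density : is_density mu p0.
Hypothesis Theta_full : natural_parameters mu p0 = [set: R].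
Hypothesis p0_mean_zero : \int[mu]_x (x * p0 x)%:E = 0.
Hypothesis cutoff : forall B : R, (0 <= B)%R ->
  exists2 T : R, (0 <= T)%R & tilt_cutoff mu p0 B T.

Local Notation P0 := (density_probability p0_density).
Local Notation h := (tilt_mixture mu p0).
Local Notation proba := (probability (measurableTypeR R) R).

Let mh (g : proba) : measurable_fun [set: measurableTypeR R] (h g).
Proof. exact: measurable_tilt_mixture. Qed.

Let h_gt0 (g : proba) x : (0 < h g x)%R.
Proof. exact: tilt_mixture_gt0. Qed.

Lemma hellinger_affinity_le (g g' : proba) (eta D : R) : (0 <= eta)%R ->
  D%:E <= hellinger2 mu (mixture mu p0 g) (mixture mu p0 g') ->
  \int[P0]_x (Num.sqrt (h g x + eta) * Num.sqrt (h g' x))%:E <=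
  (1 + Num.sqrt eta - D / 2)%:E.
Proof.
move=> eta0.
have hp := hellinger2_mixtureE p0_density Theta_full p0_mean_zero cutoff.
rewrite hp => HD.
set I1 := (X in X <= _); set I2 := \int[P0]_x _ in HD.
have mI1 : measurable_fun [set: measurableTypeR R]
    (fun x => Num.sqrt (h g x + eta) * Num.sqrt (h g' x))%R.
  apply: measurable_funM; last exact: (measurable_fun_sqrt (mh g')).
  apply: (@measurable_fun_sqrt _ _ _ _ (fun x => h g x + eta)%R).
  exact: (measurable_funD (mh g) (measurable_cst eta)).
have mI2 : measurable_fun [set: measurableTypeR R]
    (fun x => (Num.sqrt (h g x) - Num.sqrt (h g' x)) ^+ 2)%R.
  apply: measurable_funX; apply: measurable_funB.
    exact: (measurable_fun_sqrt (mh g)).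
  exact: (measurable_fun_sqrt (mh g')).
have I10 : 0 <= I1.
  by apply: integral_ge0 => x _; rewrite lee_fin mulr_ge0 ?sqrtr_ge0.
have I20 : 0 <= I2.
  by apply: integral_ge0 => x _; rewrite lee_fin sqr_ge0.
have hint k : \int[P0]_x (h k x)%:E = 1.
  exact: integral_tilt_mixture.
have se0 := sqrtr_ge0 eta.
have mE k : measurable_fun [set: measurableTypeR R] (fun x => (h k x)%:E).
  apply/measurable_EFinP; exact: mh.
have key : I1 + 2^-1%:E * I2 <= (1 + Num.sqrt eta)%:E.
  have -> : I1 + 2^-1%:E * I2 = \int[P0]_x
      ((Num.sqrt (h g x + eta) * Num.sqrt (h g' x))%:E +
       2^-1%:E * ((Num.sqrt (h g x) - Num.sqrt (h g' x)) ^+ 2)%:E).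
    rewrite ge0_integralD//.
    - rewrite ge0_integralZl//; [exact/measurable_EFinP|by move=> x _; rewrite lee_fin sqr_ge0].
    - exact/measurable_EFinP.
    - by move=> x _; rewrite -EFinM lee_fin mulr_ge0 ?sqr_ge0.
    - by apply: measurable_funeM; exact/measurable_EFinP.
  have -> : (1 + Num.sqrt eta)%:E = \int[P0]_x
      (2^-1%:E * (h g x)%:E + ((1 + Num.sqrt eta) / 2)%:E * (h g' x)%:E
       + (Num.sqrt eta / 2)%:E).
    have ge x k : 0 <= (h k x)%:E by rewrite lee_fin ltW.
    have c0 : 0 <= ((1 + Num.sqrt eta) / 2)%:E.
      by rewrite lee_fin divr_ge0// addr_ge0.
    rewrite ge0_integralD//.
    - rewrite ge0_integralD//.
      + rewrite !ge0_integralZl//.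
        rewrite !hint !mule1 integral_cst// [X in _ + _ * X]probability_setT mule1.
        by rewrite -!EFinD; congr EFin; lra.
      + by move=> x _; rewrite mule_ge0.
      + exact: measurable_funeM.
      + by move=> x _; rewrite mule_ge0.
      + exact: measurable_funeM.
    - by move=> x _; rewrite adde_ge0// mule_ge0.
    - by apply: emeasurable_funD; exact: measurable_funeM.
  apply: ge0_le_integral => //.
  - move=> x _; apply: adde_ge0; first by rewrite lee_fin mulr_ge0 ?sqrtr_ge0.
    by rewrite -EFinM lee_fin mulr_ge0 ?invr_ge0 ?sqr_ge0.
  - apply: emeasurable_funD; first exact/measurable_EFinP.
    by apply: measurable_funeM; exact/measurable_EFinP.
  - apply: emeasurable_funD; last exact: measurable_cst.
    by apply: emeasurable_funD; apply: measurable_funeM.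
  - move=> x _; rewrite -!EFinM -!EFinD lee_fin.
    have := sqrtr_affinity_le (ltW (h_gt0 g x)) (ltW (h_gt0 g' x)) eta0.
    by lra.
have : I1 + (D / 2)%:E <= (1 + Num.sqrt eta)%:E.
  apply: le_trans key; rewrite leeD2l// mulrC EFinM.
  by apply: lee_wpmul2l => //; rewrite lee_fin.
by rewrite EFinB leeBrDr.
Qed.

End likelihood_ratio.

Section iid_mixture_sample.
Local Open Scope ereal_scope.
Context (R : realType).
Variables (mu : {measure set (measurableTypeR R) -> \bar R}) (p0 : R -> R).
Hypothesis p0_density : is_density mu p0.
Hypothesis Theta_full : natural_parameters mu p0 = [set: R].
Hypothesis p0_mean_zero : \int[mu]_x (x * p0 x)%:E = 0.
Hypothesis cutoff : forall B : R, (0 <= B)%R ->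
  exists2 T : R, (0 <= T)%R & tilt_cutoff mu p0 B T.

Local Notation P0 := (density_probability p0_density).
Local Notation h := (tilt_mixture mu p0).
Local Notation proba := (probability (measurableTypeR R) R).

Let mh (g : proba) : measurable_fun [set: measurableTypeR R] (h g).
Proof. exact: measurable_tilt_mixture. Qed.

Let h_gt0 (g : proba) x : (0 < h g x)%R.
Proof. exact: tilt_mixture_gt0. Qed.

Let mixE (g : proba) x : mixture mu p0 g x = (h g x * p0 x)%R.
Proof. exact: mixtureE. Qed.

Let p0_ge0 x : (0 <= p0 x)%R. Proof. by case: p0_density. Qed.

Lemma loglik_mixtureE n (x : n.-tuple (measurableTypeR R)) (g : proba) :
  (forall i, 0 < p0 (tnth x i))%R ->
  loglik x (mixture mu p0 g) =
  (\sum_(i < n) ln (h g (tnth x i)) + \sum_(i < n) ln (p0 (tnth x i)))%R%:E.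
Proof.
move=> p00; rewrite -big_split -sumEFin; apply: eq_bigr => i _.
by rewrite lne_EFin mixE ?mulr_gt0// lnM ?posrE//=.
Qed.

Variable g0 : proba.

Definition sqrt_ratio (eta : R) (g : proba) (x : R) : R :=
  (Num.sqrt (h g x + eta) / Num.sqrt (h g0 x))%R.

Lemma sqrt_ratio_ge0 eta g x : (0 <= sqrt_ratio eta g x)%R.
Proof. by rewrite divr_ge0 ?sqrtr_ge0. Qed.

Lemma measurable_sqrt_ratio eta g :
  measurable_fun [set: measurableTypeR R] (sqrt_ratio eta g).
Proof.
apply: measurable_funM.
  exact: (measurable_fun_sqrt (measurable_funD (mh g) (measurable_cst eta))).
apply: (@eq_measurable_fun _ _ _ _ _ (fun x => expR (- ln (Num.sqrt (h g0 x))))%R).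
  by move=> x _; rewrite expRN lnK// posrE sqrtr_gt0.
apply: measurableT_comp => //; apply: measurableT_comp => //.
apply: measurableT_comp => //; exact: (measurable_fun_sqrt (mh g0)).
Qed.

Lemma npmle_sqrt_ratio_ge (B eta a : R) n (x : n.-tuple (measurableTypeR R))
    (ghat g g' : proba) :
  (0 <= eta)%R ->
  (forall y, `|y| <= B -> `|h g y - h g' y| <= eta)%R ->
  (forall i, `|tnth x i| <= B)%R -> (forall i, 0 < p0 (tnth x i))%R ->
  is_npmle mu p0 x ghat ->
  loglik x (mixture mu p0 ghat) - loglik x (mixture mu p0 g) <= a%:E ->
  (expR (- a / 2) <= \prod_(i < n) sqrt_ratio eta g' (tnth x i))%R.
Proof.
move=> eta0 gg' xB p00 /(_ g0) H0.
move: H0; rewrite !loglik_mixtureE// -EFinB !lee_fin => H0 H1.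
have -> : (\prod_(i < n) sqrt_ratio eta g' (tnth x i) =
    expR (\sum_(i < n) (ln (h g' (tnth x i) + eta) - ln (h g0 (tnth x i))) / 2))%R.
  rewrite expR_sum; apply: eq_bigr => i _.
  have s y : (0 < y)%R -> Num.sqrt y = expR (ln y / 2) :> R.
    by move=> y0; rewrite -powR12_sqrt ?ltW// /powR gt_eqF// mulrC.
  rewrite mulrBl expRB /sqrt_ratio -!s//.
  by rewrite ltr_wpDr.
rewrite ler_expR -mulr_suml ler_wpM2r ?invr_ge0// sumrB.
have : (\sum_(i < n) ln (h g (tnth x i)) <= \sum_(i < n) ln (h g' (tnth x i) + eta))%R.
  apply: ler_sum => i _; rewrite ler_ln ?posrE//; last by rewrite ltr_wpDr.
  by have := gg' _ (xB i); rewrite ler_norml => /andP[_]; lra.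
lra.
Qed.

Variables (d : measure_display) (Omega : measurableType d).
Variables (P : probability Omega R) (X : nat -> {RV P >-> measurableTypeR R}).
Hypothesis iidX : iid_density mu (mixture mu p0 g0) X.

Lemma integral_iid_mixture i (f : R -> R) :
  measurable_fun [set: measurableTypeR R] f -> (forall x, 0 <= f x)%R ->
  \int[P]_w (f (X i w))%:E = \int[P0]_x (f x * h g0 x)%:E.
Proof.
move=> mf f0.
have mfE : measurable_fun [set: measurableTypeR R] (EFin \o f).
  exact/measurable_EFinP.
have mm : measurable_fun [set: measurableTypeR R] (mixture mu p0 g0).
  apply: (@eq_measurable_fun _ _ _ _ _ (fun x => h g0 x * p0 x)%R).
    by move=> x _; rewrite mixE.
  exact: measurable_funM (mh g0) (density_measurable p0_density).
have m0 x : (0 <= mixture mu p0 g0 x)%R by rewrite mixE mulr_ge0// ltW.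
rewrite -[LHS](ge0_integral_distribution (X i) mfE); last first.
  by move=> x; rewrite lee_fin.
transitivity (\int[density_measure mu mm m0]_x (f x)%:E).
  by apply: eq_measure_integral => A mA _; exact: iidX.2.
rewrite ge0_integral_density//.
rewrite ge0_integral_density_probability.
- by apply: eq_integral => x _; rewrite mixE -!EFinM mulrA.
- by apply/measurable_EFinP; exact: measurable_funM.
- by move=> x; rewrite lee_fin mulr_ge0// ltW.
Qed.

Lemma sqrt_ratio_tail n (eta D a : R) (g : proba) : (0 <= eta)%R ->
  D%:E <= hellinger2 mu (mixture mu p0 g) (mixture mu p0 g0) ->
  P [set w | (expR (- a) <= \prod_(i < n) sqrt_ratio eta g (X i w))%R] <=
  (expR (a + n%:R * (Num.sqrt eta - D / 2)))%:E.
Proof.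
move=> eta0 HD.
pose f := sqrt_ratio eta g.
have mf : measurable_fun [set: measurableTypeR R] f by exact: measurable_sqrt_ratio.
have f0 x : (0 <= f x)%R by exact: sqrt_ratio_ge0.
have Ef i : \int[P]_w (f (X i w))%:E <= (1 + Num.sqrt eta - D / 2)%:E.
  rewrite integral_iid_mixture//.
  apply: le_trans (hellinger_affinity_le p0_density Theta_full p0_mean_zero
    cutoff eta0 HD).
  rewrite le_eqVlt; apply/orP; left; apply/eqP; apply: eq_integral => x _.
  rewrite /f /sqrt_ratio -mulrA; congr (_ * _)%:E.
  by rewrite -{2}(sqr_sqrtr (ltW (h_gt0 g0 x))) expr2 mulKf// gt_eqF// sqrtr_gt0.
pose Y w := (\prod_(i < n) f (X i w))%R.
have mY : measurable_fun [set: Omega] Y.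
  by apply: measurable_bigprod => i _; apply: measurableT_comp.
have Y0 w : (0 <= Y w)%R by apply: prodr_ge0 => i _.
have EY : \int[P]_w (Y w)%:E <= (expR (n%:R * (Num.sqrt eta - D / 2)))%:E.
  rewrite (@expectation_prod_independent _ _ _ P X iidX.1 n (fun=> f))//; last first.
    by move=> i; rewrite (le_lt_trans (Ef i))// ltry.
  have pos i : 0 <= \int[P]_w (f (X i w))%:E.
    by apply: integral_ge0 => w _; rewrite lee_fin.
  have fin i : \int[P]_w (f (X i w))%:E = (fine (\int[P]_w (f (X i w))%:E))%:E.
    by rewrite fineK// ge0_fin_numE// (le_lt_trans (Ef i))// ltry.
  under eq_bigr do rewrite fin.
  rewrite prodEFin lee_fin expRM_natl -[n in leRHS]card_ord -prodr_const.
  apply: ler_prod => i _; rewrite fine_ge0//= -lee_fin -fin.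
  apply: le_trans (Ef i) _; rewrite lee_fin.
  by apply: le_trans (expR_ge1Dx _); rewrite addrA.
have := le_integral_abse P measurableT (g := EFin \o Y) _ (expR_gt0 (- a)).
rewrite setTI => /(_ ltac:(exact/measurable_EFinP)).
under eq_integral do rewrite gee0_abs ?lee_fin//.
move=> /le_trans /(_ EY).
have -> : [set w | (expR (- a))%:E <= `|(EFin \o Y) w|] =
    [set w | (expR (- a) <= \prod_(i < n) sqrt_ratio eta g (X i w))%R].
  by apply/seteqP; split=> w /=; rewrite lee_fin ger0_norm.
rewrite muleC expRN -lee_pdivlMr ?invr_gt0 ?expR_gt0// invrK.
by rewrite -EFinM -expRD (addrC _ a).
Qed.


End iid_mixture_sample.

Section sample_measurability.
Local Open Scope ereal_scope.

Lemma measure_bigsetU_le d (T : measurableType d) (R : realType)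
    (P : {measure set T -> \bar R}) (I : Type) (s : seq I) (F : I -> set T) :
  (forall i, measurable (F i)) ->
  P (\big[setU/set0]_(i <- s) F i) <= \sum_(i <- s) P (F i).
Proof.
move=> mF; elim: s => [|i s IH]; first by rewrite !big_nil measure0.
rewrite !big_cons; apply: le_trans (measureU2 _ _ _) _ => //.
  exact: bigsetU_measurable.
exact: leeD2l.
Qed.

Lemma measurable_absmax (R : realType) n :
  measurable_fun [set: n.-tuple (measurableTypeR R)] (@absmax R n).
Proof.
rewrite /absmax; elim: (index_enum _) => [|i s IH].
  by under eq_fun do rewrite big_nil; exact: measurable_cst.
under eq_fun do rewrite big_cons.
apply: measurable_maxr => //.
apply: measurableT_comp => //; exact: measurable_tnth.
Qed.

Lemma le_absmax (R : realType) n (x : n.-tuple (measurableTypeR R)) i :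
  (`|tnth x i| <= absmax x)%R.
Proof. exact: le_bigmax. Qed.

Lemma measurable_sample (R : realType) d (Omega : measurableType d)
    (P : probability Omega R) (X : nat -> {RV P >-> measurableTypeR R}) n :
  measurable_fun [set: Omega] (sample X n).
Proof.
apply/measurable_fun_tnthP => i.
rewrite (_ : _ \o _ = X i)//.
by apply/funext => w /=; rewrite tnth_mktuple.
Qed.

End sample_measurability.

Section deviation.
Local Open Scope ereal_scope.
Context (R : realType).
Variables (mu : {measure set (measurableTypeR R) -> \bar R}) (p0 : R -> R).
Hypothesis p0_density : is_density mu p0.
Hypothesis Theta_full : natural_parameters mu p0 = [set: R].
Hypothesis p0_mean_zero : \int[mu]_x (x * p0 x)%:E = 0.
Hypothesis cutoff : forall B : R, (0 <= B)%R ->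
  exists2 T : R, (0 <= T)%R & tilt_cutoff mu p0 B T.

Local Notation proba := (probability (measurableTypeR R) R).

Variable g0 : proba.
Variables (d : measure_display) (Omega : measurableType d).
Variables (P : probability Omega R) (X : nat -> {RV P >-> measurableTypeR R}).
Hypothesis iidX : iid_density mu (mixture mu p0 g0) X.

Lemma measurable_density_zero :
  measurable ([set x | p0 x = 0%R] : set (measurableTypeR R)).
Proof.
have := density_measurable p0_density measurableT (measurable_set1 0%R).
by rewrite setTI.
Qed.

Lemma density_zero_null i : P (X i @^-1` [set x | p0 x = 0%R]) = 0.
Proof.
have /= := iidX.2 i _ measurable_density_zero.
move=> H; rewrite -[LHS]/(distribution P (X i) [set x | p0 x = 0%R]) H.
apply: integral0_eq => x /= p00.
by rewrite (mixtureE p0_density Theta_full p0_mean_zero cutoff) p00 mulr0.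
Qed.

Lemma deviation_bound (n N : nat) (B T eps eta D a : R)
    (ghat : n.-tuple (measurableTypeR R) -> proba)
    (gtilde : n.-tuple (measurableTypeR R) -> pprobability (measurableTypeR R) R) :
  (0 < B)%R -> (0 <= T)%R -> tilt_cutoff mu p0 B T -> (0 < eps)%R ->
  (0 <= eta)%R ->
  (N%:R * eps + 2 * (expR (expR 1 * (T * B) - N%:R) + expR (- (T * B))) <= eta)%R ->
  (forall x, is_npmle mu p0 x (ghat x)) ->
  measurable_fun [set: n.-tuple (measurableTypeR R)] gtilde ->
  {ae P, forall w,
     loglik (sample X n w) (mixture mu p0 (ghat (sample X n w)))
      - loglik (sample X n w) (mixture mu p0 (gtilde (sample X n w))) <= a%:E} ->
  P [set w | D%:E <= hellinger2 mu (mixture mu p0 (gtilde (sample X n w)))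
                                   (mixture mu p0 g0)] <=
  P [set w | (B <= absmax (sample X n w))%R] +
  ((Num.truncn (2 * expR (T * B) / eps)).+1%:R ^+ N *
   expR (a / 2 + n%:R * (Num.sqrt eta - D / 2)))%:E.
Proof.
move=> B0 T0 cBT eps0 eta0 etaE npm mgt [N1 [mN1 PN1 subN1]].
have [cell Hcell] := tilt_mixture_cells p0_density Theta_full p0_mean_zero
  cutoff B0 T0 cBT N eps0.
set M := (Num.truncn _).+1 in cell Hcell *.
pose far (g : proba) := D%:E <= hellinger2 mu (mixture mu p0 g) (mixture mu p0 g0).
pose F (c : {ffun 'I_N -> 'I_M}) : set Omega :=
  if pselect (exists2 g, cell g = c & far g) is left e then
    [set w | (expR (- (a / 2)) <=
      \prod_(i < n) sqrt_ratio mu p0 g0 eta (s2val (cid2 e)) (X i w))%R]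
  else set0.
have mratio g : measurable_fun [set: measurableTypeR R] (sqrt_ratio mu p0 g0 eta g).
  exact: measurable_sqrt_ratio.
have mF c : measurable (F c).
  rewrite /F; case: pselect => // e.
  rewrite -[X in measurable X]setTI.
  apply: measurable_fun_le => //.
  by apply: measurable_bigprod => i _; apply: measurableT_comp.
have PF c : P (F c) <= (expR (a / 2 + n%:R * (Num.sqrt eta - D / 2)))%:E.
  rewrite /F; case: pselect => [e|_]; last by rewrite measure0 lee_fin expR_ge0.
  apply: sqrt_ratio_tail => //.
  exact: (s2valP' (cid2 e)).
pose E1 := [set w | (B <= absmax (sample X n w))%R].
have mE1 : measurable E1.
  rewrite -[X in measurable X]setTI; apply: measurable_fun_le => //.
  apply: (measurableT_comp (@measurable_absmax R n)); exact: measurable_sample.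
pose N2 := \big[setU/set0]_(i < n) (X i @^-1` [set x | p0 x = 0%R]).
have mN2i i : measurable (X i @^-1` [set x | p0 x = 0%R]).
  rewrite -[X in measurable X]setTI; apply: measurable_funP => //.
  exact: measurable_density_zero.
have mN2 : measurable N2 by apply: bigsetU_measurable.
have PN2 : P N2 = 0.
  apply/eqP; rewrite -measure_le0.
  apply: le_trans (measure_bigsetU_le P _ (fun i : 'I_n => mN2i i)) _.
  by rewrite big1// => i _; exact: density_zero_null.
pose UF := \big[setU/set0]_(c <- enum {: {ffun 'I_N -> 'I_M}}) F c.
have mUF : measurable UF by apply: bigsetU_measurable.
have PUF : P UF <= (M%:R ^+ N * expR (a / 2 + n%:R * (Num.sqrt eta - D / 2)))%:E.
  apply: le_trans (measure_bigsetU_le P _ mF) _.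
  apply: (@le_trans _ _ (\sum_(c <- enum {: {ffun 'I_N -> 'I_M}})
     (expR (a / 2 + n%:R * (Num.sqrt eta - D / 2)))%:E)).
    by apply: lee_sum => c _; exact: PF.
  rewrite big_enum sumEFin lee_fin sumr_const card_ffun !card_ord.
  by rewrite -natrX [leRHS]mulr_natl.
set E := [set w | _].
have mE : measurable E.
  rewrite -[X in measurable X]setTI; apply: emeasurable_fun_c_infty => //.
  have mG : measurable_fun [set: Omega] (gtilde \o sample X n).
    by apply: measurableT_comp => //; exact: measurable_sample.
  exact: (measurable_hellinger2_mixture p0_density Theta_full p0_mean_zero
    cutoff g0 mG).
have sub : E `<=` (E1 `|` UF) `|` (N1 `|` N2).
  move=> w Ew.
  have [N1w|nN1w] := pselect (N1 w); first by right; left.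
  have [N2w|nN2w] := pselect (N2 w); first by right; right.
  have [E1w|nE1w] := pselect (E1 w); first by left; left.
  left; right.
  have sX i : tnth (sample X n w) i = X i w by rewrite tnth_mktuple.
  set g : proba := gtilde (sample X n w).
  have farg : far g by exact: Ew.
  rewrite /UF -bigcup_seq; exists (cell g) => /=; first by rewrite mem_enum.
  rewrite /F; case: pselect => [e|]; last by case; exists g.
  set g' := s2val _.
  have cg' : cell g' = cell g by exact: (s2valP (cid2 e)).
  have := @npmle_sqrt_ratio_ge _ _ _ p0_density Theta_full p0_mean_zero cutoff
    g0 B eta a n (sample X n w) (ghat (sample X n w)) g g'.
  rewrite /= mulNr => H.
  under eq_bigr do rewrite -sX.
  apply: H => //.
  - by move=> y yB; apply: le_trans etaE; exact: Hcell.
  - move=> i; apply: le_trans (le_absmax _ _) _.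
    by move/negP : nE1w; rewrite -ltNge => /ltW.
  - move=> i; rewrite sX lt_neqAle (density_ge0 p0_density) andbT eq_sym.
    apply/eqP => p00; apply: nN2w.
    by rewrite /N2 -bigcup_seq; exists i => //=; rewrite mem_index_enum.
  - by apply: contrapT => H1; apply: nN1w; exact: subN1.
have mG1 : measurable (E1 `|` UF) by exact: measurableU.
have mG2 : measurable (N1 `|` N2) by exact: measurableU.
have PN12 : P (N1 `|` N2) = 0.
  apply/eqP; rewrite -measure_le0; apply: le_trans (measureU2 P mN1 mN2) _.
  by rewrite [X in X + _]PN1 [X in _ + X]PN2 adde0.
apply: (@le_trans _ _ (P ((E1 `|` UF) `|` (N1 `|` N2)))).
  by apply: le_measure; rewrite ?inE//; exact: measurableU.
apply: (@le_trans _ _ (P (E1 `|` UF) + P (N1 `|` N2))); first exact: measureU2.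
rewrite PN12 adde0.
apply: (@le_trans _ _ (P E1 + P UF)); first exact: measureU2.
exact: leeD2l.
Qed.

End deviation.

Section rate.
Context (R : realType).
Implicit Types (alpha beta t l L Y : R).

Lemma truncation_scale alpha c0 c1 beta b0 b1 :
  0 < alpha -> 0 < c1 -> 0 < beta -> 0 < b0 -> 0 < b1 ->
  exists K1 K3 : R, [/\ 1 <= K1, 2 <= K3 & forall L, 1 <= L -> exists B T : R,
    [/\ [/\ 0 < B, b0 <= B, c0 <= T & 2 * B <= c1 * T `^ alpha^-1],
        T * B = K3 * (K1 * L) &
        2 * L `^ (beta / (1 + alpha)) <= b1 * B `^ beta]].
Proof.
move=> alpha0 c10 beta0 b00 b10.
have a1 : 0 < 1 + alpha by rewrite addr_gt0.
set r := beta / (1 + alpha).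
have r0 : 0 < r by exact: divr_gt0.
pose K1 := Num.max 1 (Num.max ((2 / b1) `^ r^-1) (b0 `^ (1 + alpha))).
have K11 : 1 <= K1 by rewrite /K1 le_max lexx.
have K1b1 : (2 / b1) `^ r^-1 <= K1 by rewrite /K1 !le_max lexx orbT.
have K1b0 : b0 `^ (1 + alpha) <= K1 by rewrite /K1 !le_max lexx !orbT.
have K10 : 0 < K1 by exact: lt_le_trans K11.
have K1r : 2 <= b1 * K1 `^ r.
  rewrite -ler_pdivrMl// mulrC.
  have b20 : 0 <= 2 / b1 by rewrite divr_ge0// ltW.
  have -> : 2 / b1 = ((2 / b1) `^ r^-1) `^ r.
    by rewrite -powRrM mulVf ?gt_eqF// powRr1.
  by rewrite ge0_ler_powR ?nnegrE ?powR_ge0// ltW.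
pose K3 := Num.max 2 (Num.max c0 ((2 / c1) `^ alpha)).
have K32 : 2 <= K3 by rewrite /K3 le_max lexx.
have K3c0 : c0 <= K3 by rewrite /K3 !le_max lexx orbT.
have K3c1 : (2 / c1) `^ alpha <= K3 by rewrite /K3 !le_max lexx !orbT.
have K30 : 0 < K3 by exact: lt_le_trans K32.
have K3a : 2 <= c1 * K3 `^ alpha^-1.
  rewrite -ler_pdivrMl// mulrC.
  have b20 : 0 <= 2 / c1 by rewrite divr_ge0// ltW.
  have -> : 2 / c1 = ((2 / c1) `^ alpha) `^ alpha^-1.
    by rewrite -powRrM mulfV ?gt_eqF// powRr1.
  by rewrite ge0_ler_powR ?nnegrE ?powR_ge0 ?invr_ge0// ltW.
exists K1, K3; split=> // L L1.
have L0 : 0 < L by exact: lt_le_trans L1.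
pose S := K1 * L.
have S0 : 0 < S by exact: mulr_gt0.
pose B := S `^ (1 + alpha)^-1.
have B0 : 0 < B by exact: powR_gt0.
have BS : B `^ (1 + alpha) = S.
  by rewrite -powRrM mulVf ?gt_eqF// powRr1// ltW.
have S1 : 1 <= S by rewrite -[leLHS]mulr1 ler_pM.
have B1 : 1 <= B.
  have : 1 `^ (1 + alpha)^-1 <= B.
    by rewrite ge0_ler_powR ?nnegrE ?invr_ge0 ?(ltW a1) ?(ltW S0).
  by rewrite powR1.
exists B, (K3 * B `^ alpha); split.
- split=> //.
  + have -> : b0 = (b0 `^ (1 + alpha)) `^ (1 + alpha)^-1.
      by rewrite -powRrM mulfV ?gt_eqF// powRr1// ltW.
    rewrite ge0_ler_powR ?nnegrE ?powR_ge0 ?invr_ge0 ?(ltW a1) ?(ltW S0)//.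
    by apply: le_trans K1b0 _; rewrite -[leLHS]mulr1 (ler_wpM2l (ltW K10)).
  + apply: le_trans K3c0 _; rewrite -[leLHS]mulr1 (ler_wpM2l (ltW K30))//.
    by rewrite -[leLHS](powRr0 B) ler_powR// ltW.
  + rewrite powRM ?powR_ge0 ?(ltW K30)// -powRrM mulfV ?gt_eqF// powRr1 ?(ltW B0)//.
    by rewrite mulrA ler_wpM2r// ltW.
- by rewrite -/S -BS powRD ?gt_eqF// powRr1 ?(ltW B0)// (mulrC B) mulrA.
- have -> : B `^ beta = S `^ r by rewrite -powRrM mulrC.
  rewrite /S powRM ?(ltW K10) ?(ltW L0)// [leRHS]mulrA.
  by rewrite ler_wpM2r ?powR_ge0.
Qed.

Lemma log_scale alpha beta t l : 0 < alpha -> 0 < beta -> 1 <= t -> 1 <= l ->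
  let q := Num.max ((1 + alpha) / beta) 1 in
  let gamma1 := Num.min (beta / (2 * (1 + alpha))) 1 in
  let L := t `^ 2^-1 * l `^ q in
  [/\ l <= L, L ^+ 2 = t * l `^ (2 * q), t `^ gamma1 * l <= L ^+ 2,
      t `^ gamma1 * l <= L `^ (beta / (1 + alpha)) & l <= t `^ gamma1 * l].
Proof.
move=> alpha0 beta0 t1 l1 q gamma1 L.
have a1 : 0 < 1 + alpha by rewrite addr_gt0.
set r := beta / (1 + alpha).
have r0 : 0 < r by exact: divr_gt0.
have q1 : 1 <= q by rewrite /q le_max lexx orbT.
have qr : 1 <= q * r.
  have H : (1 + alpha) / beta <= q by rewrite /q le_max lexx.
  have -> : 1 = (1 + alpha) / beta * r by rewrite /r; field; rewrite !gt_eqF.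
  by rewrite ler_wpM2r// ltW.
have g1r : gamma1 <= 2^-1 * r.
  rewrite /gamma1 ge_min; apply/orP; left.
  by rewrite /r invfM mulrCA.
have g11 : gamma1 <= 1 by rewrite /gamma1 ge_min lexx orbT.
have g10 : 0 <= gamma1.
  by rewrite /gamma1 le_min ler01 andbT divr_ge0 ?mulr_ge0 ?(ltW beta0) ?(ltW a1).
have t0 : 0 < t by exact: lt_le_trans t1.
have l0 : 0 < l by exact: lt_le_trans l1.
have L2 : L ^+ 2 = t * l `^ (2 * q).
  rewrite exprMn -!powR_mulrn ?powR_ge0// -!powRrM mulVf// powRr1 ?ltW//.
  by rewrite (mulrC q).
split => //.
- rewrite -[leLHS]mul1r ler_pM ?(ltW l0)//; last exact: le1r_powR.
  by rewrite -[leLHS](powRr0 t) ler_powR// invr_ge0.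
- rewrite L2 ler_pM ?powR_ge0 ?(ltW l0)//.
    by rewrite -[leRHS](powRr1 (ltW t0)) ler_powR.
  apply: le1r_powR => //.
  by rewrite -[leLHS]mulr1 ler_pM// ler1n.
- rewrite /L powRM ?powR_ge0// -!powRrM ler_pM ?powR_ge0 ?(ltW l0)//.
    by rewrite ler_powR.
  by apply: le1r_powR.
- by rewrite -[leLHS]mul1r ler_wpM2r ?(ltW l0)// -[leLHS](powRr0 t) ler_powR.
Qed.

Lemma cell_count_le Y l (N : nat) : 0 <= Y -> 0 <= l -> (0 < N)%N ->
  (Num.truncn (2 * expR Y / (expR (- (2 * l)) / N%:R))).+1%:R <=
  expR (Y + N%:R + 2 * l + 2).
Proof.
move=> Y0 l0 N0; set eps := expR _ / _.
have NR0 : 0 < N%:R :> R by rewrite ltr0n.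
have eps0 : 0 < eps by rewrite divr_gt0 ?expR_gt0.
have M0 : 0 <= 2 * expR Y / eps.
  by rewrite divr_ge0 ?mulr_ge0 ?expR_ge0// ltW.
have /andP[H _] := truncn_itv M0.
pose E := expR (Y + N%:R + 2 * l).
have EE : 2 * expR Y / eps = 2 * N%:R * (expR Y * expR (2 * l)).
  by rewrite /eps expRN; field; rewrite ?gt_eqF ?expR_gt0.
have E1 : 1 <= E by rewrite /E -[leLHS]expR0 ler_expR !addr_ge0// mulr_ge0.
have H2 : 2 * expR Y / eps <= 2 * E.
  have -> : E = expR N%:R * (expR Y * expR (2 * l)).
    by rewrite -!expRD /E; congr expR; ring.
  rewrite EE -mulrA ler_wpM2l// ler_wpM2r ?mulr_ge0 ?expR_ge0//.
  by apply: le_trans (expR_ge1Dx _); rewrite lerDr.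
have H3 : 3 <= expR 2 :> R.
  by apply: le_trans (expR_ge1Dx _); rewrite (_ : 3 = 1 + 2 :> R)// -natrD.
rewrite -natr1 expRD -/E.
have : 3 * E <= E * expR 2 by rewrite mulrC ler_wpM2l// expR_ge0.
by move: H H2 E1; clear; lra.
Qed.

Lemma rate_parameters alpha c0 c1 beta b0 b1 (A : R) :
  0 < alpha -> 0 < c1 -> 0 < beta -> 0 < b0 -> 0 < b1 -> 0 < A ->
  let gamma0 := 2 * Num.max ((1 + alpha) / beta) 1 in
  let gamma1 := Num.min (beta / (2 * (1 + alpha))) 1 in
  exists2 C : R, 0 < C & forall (n : nat) t, 1 <= t -> C <= n%:R ->
  exists (B T : R) (N : nat) (eps eta : R),
  [/\ [/\ 0 < B, b0 <= B, c0 <= T & 2 * B <= c1 * T `^ alpha^-1],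
      [/\ 0 < eps, 0 <= eta &
          N%:R * eps + 2 * (expR (expR 1 * (T * B) - N%:R) + expR (- (T * B)))
          <= eta],
      n%:R * expR (- b1 * B `^ beta) <= expR (- (t `^ gamma1 * ln n%:R)) &
      (Num.truncn (2 * expR (T * B) / eps)).+1%:R ^+ N *
      expR (A * ln n%:R `^ gamma0 / 2 + n%:R *
            (Num.sqrt eta - t * C * (ln n%:R `^ gamma0 / n%:R) / 2)) <=
      expR (- (t `^ gamma1 * ln n%:R))].
Proof.
move=> alpha0 c10 beta0 b00 b10 A0 gamma0 gamma1.
have [K1 [K3 [K11 K32 HK]]] := truncation_scale c0 alpha0 c10 beta0 b00 b10.
have K10 : 0 < K1 by exact: lt_le_trans K11.
have K30 : 0 < K3 by exact: lt_le_trans K32.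
have e1 : 0 < expR 1 :> R by exact: expR_gt0.
pose K4 := expR 1 * K3 + 3.
pose K5 := K3 + K4 + 4.
pose K6 := K5 * K4 * K1 ^+ 2.
have K40 : 0 < K4 by rewrite addr_gt0// mulr_gt0.
have K50 : 0 < K5 by apply: addr_gt0 => //; exact: addr_gt0.
have K60 : 0 < K6 by rewrite /K6 !mulr_gt0// exprn_gt0.
pose C0 := K6 + A / 2 + 4.
have C00 : 0 < C0 by rewrite /C0 !addr_gt0// divr_gt0.
have C20 : 0 < 2 * C0 by exact: mulr_gt0.
exists (2 * C0 + expR 1); first exact: addr_gt0.
set C := 2 * _ + _; move=> n t t1 Cn.
have en : expR 1 <= n%:R :> R by apply: le_trans Cn; rewrite lerDr ltW.
have n0 : 0 < n%:R :> R by exact: lt_le_trans en.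
have [l nE] : exists l, n%:R = expR l by exists (ln n%:R); rewrite lnK.
rewrite !nE !expRK.
have l1 : 1 <= l by rewrite -(ler_expR 1 l) -nE.
have l0 : 0 <= l by exact: le_trans l1.
pose L := t `^ 2^-1 * l `^ Num.max ((1 + alpha) / beta) 1.
have [lL L2 Lt Lr lt] : [/\ l <= L, L ^+ 2 = t * l `^ gamma0,
    t `^ gamma1 * l <= L ^+ 2, t `^ gamma1 * l <= L `^ (beta / (1 + alpha)) &
    l <= t `^ gamma1 * l].
  exact: log_scale.
have L1 : 1 <= L by apply: le_trans lL.
have L0 : 0 < L by exact: lt_le_trans L1.
have [B [T [BT TB BL]]] := HK L L1.
pose S := K1 * L.
have S0 : 0 < S by exact: mulr_gt0.
have LS : L <= S by rewrite -[leLHS]mul1r ler_wpM2r// ltW.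
have lS : l <= S by exact: le_trans LS.
have S1 : 1 <= S by exact: le_trans lS.
have KS0 : 0 <= K3 * S by rewrite mulr_ge0 ?ltW.
have KSl : 2 * l <= K3 * S by rewrite ler_pM.
rewrite -/S in TB.
pose N := (Num.truncn (expR 1 * (K3 * S) + 2 * l)).+1.
have [NL NU] : N%:R <= K4 * S /\ expR 1 * (K3 * S) + 2 * l <= N%:R.
  have eS0 : 0 <= expR 1 * (K3 * S) + 2 * l.
    by apply: addr_ge0; apply: mulr_ge0 => //; exact: ltW.
  have /andP[H1 H2] := truncn_itv eS0; split; last exact: ltW.
  have -> : K4 * S = expR 1 * (K3 * S) + 3 * S by rewrite /K4; ring.
  by rewrite /N -natr1; move: H1 lS S1; clear; lra.
have N0 : 0 < N%:R :> R by rewrite ltr0n.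
exists B, T, N, (expR (- (2 * l)) / N%:R), (5 * expR (- (2 * l))).
rewrite TB; split=> //.
- split; [by rewrite divr_gt0 ?expR_gt0|by rewrite mulr_ge0 ?expR_ge0|].
  rewrite mulrC divfK ?gt_eqF//.
  have H1 : expR (expR 1 * (K3 * S) - N%:R) <= expR (- (2 * l)).
    by rewrite ler_expR; move: NU; clear; lra.
  have H2 : expR (- (K3 * S)) <= expR (- (2 * l)) by rewrite ler_expR lerN2.
  by move: H1 H2; clear; lra.
- rewrite -expRD ler_expR mulNr; move: BL Lr lt; clear.
  by set x := b1 * _; set y := L `^ _; lra.
- have M2 : (Num.truncn (2 * expR (K3 * S) / (expR (- (2 * l)) / N%:R))).+1%:R ^+ N
      <= expR (K6 * L ^+ 2) :> R.
    apply: (@le_trans _ _ (expR (K5 * S) ^+ N)).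
      rewrite lerXn2r ?nnegrE ?expR_ge0//.
      apply: le_trans (@cell_count_le _ _ N KS0 l0 isT) _; rewrite ler_expR.
      have -> : K5 * S = K3 * S + K4 * S + 4 * S by rewrite /K5; ring.
      by move: NL lS S1; clear; lra.
    rewrite -expRM_natl ler_expR.
    apply: (@le_trans _ _ (K4 * S * (K5 * S))).
      by rewrite ler_wpM2r// mulr_ge0 ?(ltW K50) ?(ltW S0).
    by rewrite le_eqVlt; apply/orP; left; apply/eqP; rewrite /K6 /S; ring.
  apply: le_trans (ler_wpM2r (expR_ge0 _) M2) _.
  rewrite -expRD ler_expR.
  have sq : expR l * Num.sqrt (5 * expR (- (2 * l))) <= 3.
    have -> : expR (- (2 * l)) = expR (- l) ^+ 2 by rewrite -expRM_natl mulrN.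
    rewrite sqrtrM// sqrtr_sqr ger0_norm ?expR_ge0// mulrCA -expRD subrr expR0 mulr1.
    rewrite -(ler_pXn2r (ltn0Sn 1)) ?nnegrE ?sqrtr_ge0// sqr_sqrtr//.
    by rewrite -natrX ler_nat.
  have -> : expR l * (Num.sqrt (5 * expR (- (2 * l))) -
        t * C * (l `^ gamma0 / expR l) / 2) =
      expR l * Num.sqrt (5 * expR (- (2 * l))) - C * L ^+ 2 / 2.
    by rewrite L2; field; rewrite gt_eqF// expR_gt0.
  have Al : A * l `^ gamma0 <= A * L ^+ 2.
    by rewrite L2 ler_wpM2l ?(ltW A0)// -[leLHS]mul1r ler_wpM2r// powR_ge0.
  have L21 : 1 <= L ^+ 2 by rewrite exprn_ege1.
  have CL : C * L ^+ 2 / 2 =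
      K6 * L ^+ 2 + A * L ^+ 2 / 2 + 4 * L ^+ 2 + expR 1 * L ^+ 2 / 2.
    by rewrite /C /C0; field.
  have eL : 0 <= expR 1 * L ^+ 2 / 2.
    by rewrite divr_ge0// mulr_ge0 ?sqr_ge0 ?(ltW e1).
  rewrite CL; move: sq Al L21 eL Lt; clear.
  set u := expR l * _; set v := A * L ^+ 2; set w := A * l `^ _.
  set z := expR 1 * _; set y := L ^+ 2; set k := K6 * y; set x := _ * l.
  by lra.
Qed.

End rate.

Unset Implicit Arguments.

Theorem theorem2p3 (R : realType)
  (mu : {measure set (measurableTypeR R) -> \bar R}) (p0 : R -> R)
  (p0_density : is_density mu p0)
  (Theta_full : natural_parameters mu p0 = [set: R])
  (p0_mean_zero : (\int[mu]_x (x * p0 x)%:E = 0)%E)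
  (alpha1 alpha2 c0 c1 c2 : R)
  (alpha12 : alpha2 <= alpha1) (alpha2_gt0 : 0 < alpha2)
  (c0_gt0 : 0 < c0) (c1_gt0 : 0 < c1) (c2_gt0 : 0 < c2)
  (kappa_growth : forall theta : R, c0 <= `|theta| ->
     c1 * `|theta| `^ (1 + alpha1^-1) <= kappa mu p0 theta /\
     kappa mu p0 theta <= c2 * `|theta| `^ (1 + alpha2^-1))
  (g0 : probability (measurableTypeR R) R)
  (beta0 b0 b1 : R)
  (beta0_gt0 : 0 < beta0) (b0_gt0 : 0 < b0) (b1_gt0 : 0 < b1)
  (A : R) (A_gt0 : 0 < A) :
  let gamma0 : R := 2 * Num.max ((1 + alpha1) / beta0) 1 in
  let gamma1 : R := Num.min (beta0 / (2 * (1 + alpha1))) 1 in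
  exists2 C : R, 0 < C &
  forall (d : measure_display) (Omega : measurableType d)
    (P : probability Omega R) (X : nat -> {RV P >-> measurableTypeR R}),
  iid_density mu (mixture mu p0 g0) X ->
  (forall (n : nat) (t : R), b0 <= t ->
     (P [set w | (t <= absmax (sample X n w))%R]
        <= (n%:R * expR (- b1 * t `^ beta0))%:E)%E) ->
  forall (n : nat)
    (ghat : n.-tuple (measurableTypeR R) -> probability (measurableTypeR R) R)
    (gtilde : n.-tuple (measurableTypeR R) ->
              pprobability (measurableTypeR R) R),
  (forall x, is_npmle mu p0 x (ghat x)) ->
  measurable_fun [set: n.-tuple (measurableTypeR R)] gtilde ->
  {ae P, forall w,
     (loglik (sample X n w) (mixture mu p0 (ghat (sample X n w)))
      - loglik (sample X n w) (mixture mu p0 (gtilde (sample X n w)))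
      <= (A * ln n%:R `^ gamma0)%:E)%E} ->
  forall t : R, 1 <= t -> C <= n%:R ->
    (P [set w | ((t * C * (ln n%:R `^ gamma0 / n%:R))%:E
                 <= hellinger2 mu (mixture mu p0 (gtilde (sample X n w)))
                                  (mixture mu p0 g0))%E]
       <= (2 * expR (- (t `^ gamma1 * ln n%:R)))%:E)%E.
Proof.
move=> gamma0 gamma1.
have a10 : 0 < alpha1 by exact: lt_le_trans alpha12.
have low theta : c0 <= `|theta| ->
    c1 * `|theta| `^ (1 + alpha1^-1) <= kappa mu p0 theta.
  by move=> /kappa_growth[].
have cut B T : 0 <= B -> c0 <= T -> 2 * B <= c1 * T `^ alpha1^-1 ->
    tilt_cutoff mu p0 B T.
  exact: superlinear_tilt_cutoff a10 c0_gt0 c1_gt0 low.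
have cutoff B : 0 <= B -> exists2 T : R, 0 <= T & tilt_cutoff mu p0 B T.
  move=> B0; pose T := Num.max c0 ((2 * B / c1) `^ alpha1).
  have cT : c0 <= T by rewrite /T le_max lexx.
  exists T; first exact: le_trans (ltW c0_gt0) cT.
  apply: cut => //; rewrite -ler_pdivrMl// mulrC.
  have B20 : 0 <= 2 * B / c1 by rewrite divr_ge0 ?mulr_ge0// ltW.
  have -> : 2 * B / c1 = ((2 * B / c1) `^ alpha1) `^ alpha1^-1.
    by rewrite -powRrM mulfV ?gt_eqF// powRr1.
  rewrite ge0_ler_powR ?nnegrE ?powR_ge0 ?invr_ge0 ?(ltW a10)//.
    exact: le_trans (ltW c0_gt0) cT.
  by rewrite /T le_max lexx orbT.
have [C C0 HC] := rate_parameters c0 a10 c1_gt0 beta0_gt0 b0_gt0 b1_gt0 A_gt0.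
exists C => // d Omega P X iidX tailX n ghat gtilde npm mgt ae t t1 Cn.
have [B [T [N [eps [eta [[B0 b0B cT BT] [eps0 eta0 etaE] tail count]]]]]] :=
  HC n t t1 Cn.
have T0 : 0 <= T by exact: le_trans (ltW c0_gt0) cT.
apply: le_trans (deviation_bound p0_density Theta_full p0_mean_zero cutoff iidX
  _ B0 T0 (cut B T (ltW B0) cT BT) eps0 eta0 etaE npm mgt ae) _.
apply: le_trans (leeD2r _ (tailX n B b0B)) _.
by rewrite -EFinD lee_fin [leRHS]mulr_natl [leRHS]mulr2n lerD.
Qed.
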